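(* Let $K\in L^2(0,2\pi)$. For every $\varepsilon>0$, there exists $N_\varepsilon\in\mathbb{N}$ such that if $n\in\mathbb{Z}$, $|n|\geq N_\varepsilon$, there is exactly one eigenvalue $\lambda\in\sigma(P_{1,K})$ with $|\lambda-n|<\varepsilon$. Moreover, $P_{1,K}$ has only finitely many additional eigenvalues.
   Context: For $K\in L^2(0,2\pi)$ (complex-valued), the operator $P_{1,K}$ in $L^2(0,2\pi)$ is defined by $$\mathrm{dom}(P_{1,K})=\{f\in H^1(0,2\pi)\mid f(0)=f(2\pi)\},\qquad (P_{1,K}f)(x)=if'(x)+f(2\pi)K(x).$$ $\sigma(P_{1,K})$ denotes its spectrum, which consists only of eigenvalues.
   Formalization: The claim is proved for 0 < ε < 1 instead of every ε > 0: for ε > 1 it is false (for K = 0 the eigenvalues are the integers, and both n and n+1 satisfy |λ − n| < ε), and at ε = 1 it fails for some K. *)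

(* Defs.v *)
From HB Require Import structures.
From mathcomp Require Import all_boot all_order all_algebra.
From mathcomp Require Import all_classical all_reals all_analysis.
From mathcomp.real_closed Require Export complex.

Set Implicit Arguments.
Unset Strict Implicit.
Unset Printing Implicit Defensive.
Import Order.TTheory GRing.Theory Num.Theory.
Import numFieldNormedType.Exports.

Local Open Scope classical_set_scope.
Local Open Scope ring_scope.
Local Open Scope complex_scope.

(* Elements of L^2(0,2pi) are represented by functions R -> R[i]: values
   outside ]0, 2pi[ are irrelevant, and equality in L^2(0,2pi) is [eqL2]. *)
Section L2.
Context {R : realType}.
Implicit Types (f g : R -> R[i]).

Definition Omega : set R := `]0, 2 * pi[.

Definition sqnormc (z : R[i]) : R := complex.Re z ^+ 2 + complex.Im z ^+ 2.

Definition cintegral f : R[i] :=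
  (\int[lebesgue_measure]_(x in Omega) complex.Re (f x)) +i*
  (\int[lebesgue_measure]_(x in Omega) complex.Im (f x)).

Definition L2 : set (R -> R[i]) := [set f |
  [/\ measurable_fun Omega (fun x => complex.Re (f x)),
      measurable_fun Omega (fun x => complex.Im (f x)) &
      lebesgue_measure.-integrable Omega (fun x => (sqnormc (f x))%:E)]].

Definition normL2 f : R :=
  Num.sqrt (\int[lebesgue_measure]_(x in Omega) sqnormc (f x)).

Definition eqL2 f g : Prop :=
  ae_eq lebesgue_measure Omega f g.

End L2.

Section H1.
Context {R : realType}.
Implicit Types (f g : R -> R[i]) (phi : R -> R).

(* C^1 functions with compact support in ]0, 2pi[ *)
Definition test_function phi : Prop :=
  [/\ forall x, derivable phi x 1,
      continuous (derive1 phi) &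
      exists a b : R, [/\ 0 < a, b < 2 * pi &
        forall x, ~ (a <= x <= b) -> phi x = 0]].

Definition weak_derivative f g : Prop :=
  forall phi, test_function phi ->
    cintegral (fun x => f x * (derive1 phi x)%:C)
    = - cintegral (fun x => g x * (phi x)%:C).

(* An element of H^1(0,2pi) is given by its representative that is continuous
   on [0, 2pi], so that the boundary values f 0 and f (2 * pi) make sense. *)
Definition H1 : set (R -> R[i]) := [set f |
  [/\ {within `[0, 2 * pi], continuous (fun x => complex.Re (f x))},
      {within `[0, 2 * pi], continuous (fun x => complex.Im (f x))},
      L2 f &
      exists2 g, L2 g & weak_derivative f g]].

End H1.

(* An unbounded operator T in L^2(0,2pi) is given by its graph: T f g means
   that f is in the domain of T and that T f = g in L^2(0,2pi). *)
Section spectrum.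
Context {R : realType}.
Variable T : (R -> R[i]) -> (R -> R[i]) -> Prop.

Definition eigenvalues : set R[i] := [set l |
  exists f g, [/\ T f g, eqL2 g (fun x => l * f x) & ~ eqL2 f (fun=> 0)]].

(* T - l maps dom T bijectively onto L^2(0,2pi), with bounded inverse *)
Definition resolvent_set : set R[i] := [set l |
  (forall f g, T f g -> eqL2 g (fun x => l * f x) -> eqL2 f (fun=> 0)) /\
  exists M : R, forall h, L2 h ->
    exists f g, [/\ T f g, eqL2 (fun x => g x - l * f x) h &
                    normL2 f <= M * normL2 h]].

Definition spectrum : set R[i] := ~` resolvent_set.

End spectrum.

Definition dom_P1 {R : realType} : set (R -> R[i]) :=
  [set f | H1 f /\ f 0 = f (2 * pi)].

(* The graph of f |-> i f' + f(2pi) K. The imaginary unit is written 0 +i* 1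
   because 'i denotes here the abstract square root of -1 of a
   numClosedFieldType, whose sign is not specified. *)
Definition P1 {R : realType} (K f g : R -> R[i]) : Prop :=
  [/\ dom_P1 f, L2 g &
      exists f', [/\ L2 f', weak_derivative f f' &
        eqL2 g (fun x => (0 +i* 1) * f' x + f (2 * pi) * K x)]].

(* Main.v *)
(* On an eigenfunction f put c = f(0) = f(2pi). Then h(x) = e^(ilx) f(x) has
   weak derivative i c e^(ilx) K(x), hence is the primitive of that function
   (du Bois-Reymond); evaluating at 2pi shows that c <> 0 and that l is a zero
   of the entire function
     Delta(l) = 1 - e^(2 pi i l) + i \int_0^(2pi) e^(ilt) K(t) dt,
   and conversely every zero is an eigenvalue.

   Bessel's inequality and the Taylor expansion of e^(izt) in z show that the
   integral and its Lipschitz constant at n + z tend to 0 as |n| grows,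
   uniformly for bounded z. So zeros of large real part in a horizontal strip
   are close to integers, and near a large integer n the equation
   Delta(n + z) = 0 is a fixed point equation for a contraction. Outside some
   strip there is no zero, because Delta(l), or e^(-2 pi i l) Delta(l), is
   close to 1 or -1 there. In particular Delta is not identically 0; being
   the image of t |-> e^(ilt) under a bounded functional, it has an everywhere
   convergent Taylor expansion at each point, so its zeros are isolated and
   compactness leaves only finitely many of them in a rectangle. *)
Require Import Defs.
From mathcomp Require Import all_boot all_order all_algebra.
From mathcomp Require Import all_classical all_reals all_analysis measurable_realfun.
From mathcomp.real_closed Require Import complex.
From mathcomp Require Import ring lra.
Import Order.TTheory GRing.Theory Num.Theory.
Import numFieldNormedType.Exports.
Local Open Scope classical_set_scope.
Local Open Scope ring_scope.
Local Open Scope complex_scope.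
Set Implicit Arguments.
Unset Strict Implicit.
Unset Printing Implicit Defensive.

Local Notation Re := complex.Re.
Local Notation Im := complex.Im.
Local Notation normc := Normc.normc.
Local Notation ii := (0 +i* 1).
Local Notation mu := lebesgue_measure.
Local Notation ccI := (`[0, 2 * pi]%classic).
Local Notation Rint f := (\int[mu]_(x in Omega) f x)%R.
(* Measurability for the sigma-algebra carried by [lebesgue_measure]. *)
Local Notation rmeas f := (measurable_fun (@Omega _ : set (measurableTypeR _))
  (f : measurableTypeR _ -> _)).

(** * Complex exponential *)

Section complex_basics.
Context {R : realType}.
Implicit Types (z w : R[i]) (a : R).

(** [K] is only square integrable, so its transform decays without any rate, and Bessel's inequality
    sees integer frequencies only. The passage to n + z works because t^j K is again in L^2: the
    Taylor terms are integer coefficients of finitely many L^2 functions, and the remainder is small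
    uniformly in n since |e^(int)| = 1. In a difference of two values the constant term cancels and
    every other term keeps a factor v, the difference of the arguments; this gives Lipschitz
    constants without differentiating under the integral.

    Near n one has Delta(n + z) = 2 pi i (T z - z), where 2 pi i T z = i Khat(n + z) - rho z and rho
    is the part of e^(2 pi i z) of order at least two. On a small disc and for large |n| both terms
    have Lipschitz constant at most 1, and 2 pi >= 4 makes T contract by 1/2.

    The contraction only controls a disc of small radius d. Uniqueness at distance eps follows
    because zeros of large real part lie within d of some integer, and d + eps <= 1 identifies that
    integer. *)

Lemma complexP z w : Re z = Re w -> Im z = Im w -> z = w.
Proof. by case: z w => [? ?] [? ?] /= -> ->. Qed.

Lemma ReD z w : Re (z + w) = Re z + Re w. Proof. by case: z; case: w. Qed.
Lemma ImD z w : Im (z + w) = Im z + Im w. Proof. by case: z; case: w. Qed.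
Lemma ReN z : Re (- z) = - Re z. Proof. by case: z. Qed.
Lemma ImN z : Im (- z) = - Im z. Proof. by case: z. Qed.
Lemma ReM z w : Re (z * w) = Re z * Re w - Im z * Im w.
Proof. by case: z; case: w. Qed.
Lemma ImM z w : Im (z * w) = Re z * Im w + Im z * Re w.
Proof. by case: z; case: w. Qed.
Lemma Re0 : Re (0 : R[i]) = 0. Proof. by []. Qed.
Lemma Im0 : Im (0 : R[i]) = 0. Proof. by []. Qed.
Lemma Re1 : Re (1 : R[i]) = 1. Proof. by []. Qed.
Lemma Im1 : Im (1 : R[i]) = 0. Proof. by []. Qed.
Lemma ReC a : Re a%:C = a. Proof. by []. Qed.
Lemma ImC a : Im a%:C = 0. Proof. by []. Qed.
Lemma ReMk a b : Re (a +i* b) = a. Proof. by []. Qed.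
Lemma ImMk a b : Im (a +i* b) = b. Proof. by []. Qed.

Definition ReImE := (ReMk, ImMk, ReD, ImD, ReN, ImN, ReM, ImM, Re0, Im0, Re1, Im1, ReC, ImC).

Lemma mulII : ii * ii = -1 :> R[i].
Proof. by apply: complexP; rewrite !ReImE; ring. Qed.

Lemma I_neq0 : ii != 0 :> R[i].
Proof. by rewrite eq_complex /= oner_eq0 andbF. Qed.

Lemma normc_sqrt z : normc z = Num.sqrt (Re z ^+ 2 + Im z ^+ 2).
Proof. by case: z. Qed.

Lemma normr_normc z : `|z| = (normc z)%:C. Proof. by []. Qed.

Lemma normc_ge0 z : 0 <= normc z. Proof. by rewrite normc_sqrt sqrtr_ge0. Qed.

Lemma sqr_normcE z : normc z ^+ 2 = Re z ^+ 2 + Im z ^+ 2.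
Proof. by rewrite normc_sqrt sqr_sqrtr// addr_ge0 ?sqr_ge0. Qed.

Lemma normc_eq0 z : (normc z == 0) = (z == 0).
Proof.
apply/eqP/eqP => [/Normc.eq0_normc//|->]; exact: Normc.normc0.
Qed.

Lemma normc_gt0 z : (0 < normc z) = (z != 0).
Proof. by rewrite lt_def normc_ge0 andbT normc_eq0. Qed.

Lemma normcD z w : normc (z + w) <= normc z + normc w.
Proof. exact: le_normcD. Qed.

Lemma normcB z w : normc (z - w) <= normc z + normc w.
Proof. by rewrite (le_trans (normcD _ _))// normcN. Qed.

Lemma normc_dist z w : normc (z - w) = normc (w - z).
Proof. by rewrite -normcN opprB. Qed.

Lemma normcX z n : normc (z ^+ n) = normc z ^+ n.
Proof.
by elim: n => [|n IH]; rewrite ?expr0 ?Normc.normc1// !exprS Normc.normcM IH.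
Qed.

Lemma normcI : normc (ii : R[i]) = 1.
Proof. by rewrite normc_sqrt /= expr0n /= add0r expr1n sqrtr1. Qed.

Lemma normc_real a : normc a%:C = `|a|.
Proof. by rewrite normc_sqrt /= expr0n /= addr0 sqrtr_sqr. Qed.

Lemma normRe_le z : `|Re z| <= normc z.
Proof.
by rewrite -(ler_pXn2r (n := 2))// ?nnegrE ?normc_ge0// sqr_normcE real_normK
  ?num_real// lerDl sqr_ge0.
Qed.

Lemma normIm_le z : `|Im z| <= normc z.
Proof.
by rewrite -(ler_pXn2r (n := 2))// ?nnegrE ?normc_ge0// sqr_normcE real_normK
  ?num_real// lerDr sqr_ge0.
Qed.

Lemma normc_le z : normc z <= `|Re z| + `|Im z|.
Proof.
rewrite -(ler_pXn2r (n := 2))// ?nnegrE ?normc_ge0 ?addr_ge0//.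
rewrite sqr_normcE sqrrD !real_normK ?num_real//.
have : 0 <= `|Re z| * `|Im z| by rewrite mulr_ge0.
lra.
Qed.

Lemma sqnormcE z : sqnormc z = normc z ^+ 2.
Proof. by rewrite sqr_normcE. Qed.

Lemma intrc_real (n : int) : (n%:~R : R[i]) = (n%:~R : R)%:C.
Proof. by rewrite rmorph_int. Qed.

Lemma natrc_real (n : nat) : (n%:R : R[i]) = (n%:R : R)%:C.
Proof. by rewrite rmorph_nat. Qed.

Lemma invc_real a : (a^-1)%:C = (a%:C)^-1.
Proof. by rewrite fmorphV. Qed.

End complex_basics.

Section complex_exponential.
Context {R : realType}.
Implicit Types (z w mu : R[i]) (s t : R).

Definition cexp z : R[i] :=
  (expR (Re z) * cos (Im z)) +i* (expR (Re z) * sin (Im z)).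

Lemma cexp0 : cexp 0 = 1.
Proof. by apply: complexP => /=; rewrite expR0 ?cos0 ?sin0 ?mulr1 ?mulr0. Qed.

Lemma cexpD z w : cexp (z + w) = cexp z * cexp w.
Proof.
by apply: complexP; rewrite /cexp !ReImE expRD ?cosD ?sinD; ring.
Qed.

Lemma normc_cexp z : normc (cexp z) = expR (Re z).
Proof.
by rewrite normc_sqrt !ReImE !exprMn -mulrDr cos2Dsin2 mulr1 sqrtr_sqr ger0_norm ?expR_ge0.
Qed.

Lemma cexp_neq0 z : cexp z != 0.
Proof. by rewrite -normc_eq0 normc_cexp gt_eqF// expR_gt0. Qed.

Lemma cexpNK z : cexp (- z) * cexp z = 1.
Proof. by rewrite -cexpD addNr cexp0. Qed.

Lemma cexp_2piI : cexp (ii * (2 * pi)%:C) = 1.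
Proof.
have -> : ii * (2 * pi)%:C = 0 +i* (2 * pi) :> R[i].
  by apply: complexP; rewrite !ReImE; ring.
by apply: complexP; rewrite /cexp !ReImE expR0 mul1r mulr_natl ?cos2pi ?sin2pi.
Qed.

Lemma cexp_2piI_int (n : int) : cexp (ii * n%:~R * (2 * pi)%:C) = 1.
Proof.
have H (m : nat) : cexp (ii * m%:R * (2 * pi)%:C) = 1.
  elim: m => [|m IH]; first by rewrite mulr0 mul0r cexp0.
  rewrite -natr1 mulrDr mulrDl cexpD IH mul1r mulr1; exact: cexp_2piI.
case: n => n; first exact: H.
rewrite NegzE mulrNz mulrN mulNr.
by rewrite -[LHS]mulr1 -[X in _ * X](H n.+1) cexpNK.
Qed.

(* Componentwise derivative: [R[i]] is not a normed module over [R]. *)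
Definition is_cderive (F : R -> R[i]) t (v : R[i]) :=
  is_derive t 1 (fun s => Re (F s)) (Re v) /\
  is_derive t 1 (fun s => Im (F s)) (Im v).

Lemma is_cderive_eq F t v w : is_cderive F t v -> v = w -> is_cderive F t w.
Proof. by move=> + <-. Qed.

Lemma is_cderive_cst z t : is_cderive (fun=> z) t 0.
Proof. by split; exact: is_derive_cst. Qed.

Lemma is_cderiveD F G t v w : is_cderive F t v -> is_cderive G t w ->
  is_cderive (fun s => F s + G s) t (v + w).
Proof.
move=> [F1 F2] [G1 G2]; split; rewrite !ReImE.
  have -> : (fun s => Re (F s + G s)) =
    (fun s => Re (F s)) + (fun s => Re (G s)) by apply/funext => s; rewrite ReD.
  exact: is_deriveD.
have -> : (fun s => Im (F s + G s)) =
  (fun s => Im (F s)) + (fun s => Im (G s)) by apply/funext => s; rewrite ImD.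
exact: is_deriveD.
Qed.

Lemma is_derive_mul (f g : R -> R) t a b : is_derive t 1 f a -> is_derive t 1 g b ->
  is_derive t 1 (fun s => f s * g s) (a * g t + f t * b).
Proof.
move=> fa gb; have := is_deriveM fa gb => /is_derive_eq; apply.
by rewrite /GRing.scale/=; ring.
Qed.

Lemma is_cderiveM F G t v w : is_cderive F t v -> is_cderive G t w ->
  is_cderive (fun s => F s * G s) t (v * G t + F t * w).
Proof.
move=> [F1 F2] [G1 G2]; split; rewrite !ReImE.
  have -> : (fun s => Re (F s * G s)) = (fun s => Re (F s) * Re (G s)) -
    (fun s => Im (F s) * Im (G s)) by apply/funext => s; rewrite ReM.
  have := is_deriveB (is_derive_mul F1 G1) (is_derive_mul F2 G2).
  by move/is_derive_eq; apply; ring.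
have -> : (fun s => Im (F s * G s)) = (fun s => Re (F s) * Im (G s)) +
  (fun s => Im (F s) * Re (G s)) by apply/funext => s; rewrite ImM.
have := is_deriveD (is_derive_mul F1 G2) (is_derive_mul F2 G1).
by move/is_derive_eq; apply; ring.
Qed.

Lemma is_cderive_real (f : R -> R) t a :
  is_derive t 1 f a -> is_cderive (fun s => (f s)%:C) t a%:C.
Proof. by move=> fa; split => //=; exact: is_derive_cst. Qed.

Lemma is_cderive_id t : is_cderive (fun s => s%:C) t 1.
Proof. by apply: is_cderive_real; exact: is_derive_id. Qed.

Lemma is_cderiveX (F : R -> R[i]) t v n : is_cderive F t v ->
  is_cderive (fun s => F s ^+ n) t (n%:R * F t ^+ n.-1 * v).
Proof.
move=> Fv; elim: n => [|n IH] /=.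
  rewrite !mul0r; under eq_fun do rewrite expr0; exact: is_cderive_cst.
under eq_fun do rewrite exprS.
apply: is_cderive_eq; first exact: is_cderiveM Fv IH.
case: n IH => [|n] _; first by rewrite expr0; ring.
by rewrite /= !exprS -[n.+2%:R]natr1; ring.
Qed.

Lemma is_derive_comp_fun (f g : R -> R) t a b : is_derive t 1 g b ->
  is_derive (g t) 1 f a -> is_derive t 1 (fun s => f (g s)) (b * a).
Proof. by move=> gb fa; rewrite mulrC; exact: (is_derive1_comp fa gb). Qed.

Lemma is_cderive_cexp F t v : is_cderive F t v ->
  is_cderive (fun s => cexp (F s)) t (v * cexp (F t)).
Proof.
move=> [F1 F2]; rewrite /cexp; split; rewrite !ReImE.
  have := is_derive_mul (is_derive_comp_fun F1 (is_derive_expR _))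
    (is_derive_comp_fun F2 (is_derive_cos _)).
  by move/is_derive_eq; apply; ring.
have := is_derive_mul (is_derive_comp_fun F1 (is_derive_expR _))
  (is_derive_comp_fun F2 (is_derive_sin _)).
by move/is_derive_eq; apply; ring.
Qed.

End complex_exponential.

(** * Taylor remainders of the exponential *)

Section taylor_remainder.
Context {R : realType}.
Implicit Types (z w : R[i]) (s t : R).

Lemma is_derive_pow n t :
  is_derive t 1 (fun s : R => s ^+ n.+1) (n.+1%:R * t ^+ n).
Proof.
have := derivableP (@exprn_derivable R n.+1 t 1).
by move/is_derive_eq; apply; rewrite exp_derive scaler1.
Qed.

(** The mean value theorem shows that c/(m+1) t^(m+1) - g does not decrease on [0, s], both for g =
    f and for g = -f. *)
Lemma monomial_majorant (f f' : R -> R) c m : f 0 = 0 ->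
  (forall t, is_derive t 1 f (f' t)) ->
  (forall t, 0 <= t <= 1 -> `|f' t| <= c * t ^+ m) ->
  forall s, 0 <= s <= 1 -> `|f s| <= c / m.+1%:R * s ^+ m.+1.
Proof.
move=> f0 ff' f'c s /andP[s0 s1].
have H (g g' : R -> R) : g 0 = 0 -> (forall t, is_derive t 1 g (g' t)) ->
    (forall t, 0 <= t <= 1 -> g' t <= c * t ^+ m) ->
    g s <= c / m.+1%:R * s ^+ m.+1.
  move=> g0 gg' g'c.
  pose h t := c / m.+1%:R * t ^+ m.+1 - g t.
  have hh' t : is_derive t 1 h (c * t ^+ m - g' t).
    have := is_deriveB (is_derive_mul (is_derive_cst (c / m.+1%:R) t 1)
      (is_derive_pow m t)) (gg' t).
    move/is_derive_eq; apply; congr (_ - _).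
    by rewrite mul0r add0r mulrA divfK// pnatr_eq0.
  have hc : {within `[0, s], continuous h}.
    apply: continuous_subspaceT => t; apply: differentiable_continuous.
    by apply/derivable1_diffP; have [] := hh' t.
  have [c0 c0s] := MVT_segment s0 (fun t _ => hh' t) hc.
  have -> : h 0 = 0 by rewrite /h expr0n/= mulr0 g0 subrr.
  move: c0s; rewrite in_itv/= !subr0 => /andP[c00 c0s] hs.
  rewrite -subr_ge0 -/(h s) hs mulr_ge0// subr_ge0 g'c// c00.
  exact: le_trans c0s s1.
rewrite ler_norml; apply/andP; split.
  have N t : is_derive t 1 (- f) ((- f') t) := is_deriveN (ff' t).
  rewrite lerNl; apply: (H _ _ _ N) => [|t t01]; first by rewrite fctE f0 oppr0.
  by have := f'c t t01; rewrite ler_norml fctE lerNl => /andP[].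
apply: (H _ _ f0 ff') => t t01; exact: le_trans (ler_norm _) (f'c t t01).
Qed.

(** The polynomial has m terms, hence degree below m: [texp 0] is 0, and [rexp 0] below is the
    exponential itself. *)
Definition texp m z : R[i] := \sum_(j < m) z ^+ j * (j`!%:R)^-1.

Definition rexp m z := cexp z - texp m z.

Lemma texpS m z : texp m.+1 z = texp m z + z ^+ m * (m`!%:R)^-1.
Proof. by rewrite /texp big_ord_recr. Qed.

Lemma texp0 z : texp 0 z = 0. Proof. by rewrite /texp big_ord0. Qed.

Lemma texp_at0 m : texp m.+1 0 = 1.
Proof.
rewrite /texp big_ord_recl expr0 big1 ?addr0 ?mul1r ?fact0 ?invr1// => i _.
by rewrite expr0n /= mul0r.
Qed.

Lemma is_cderive_texp m z t :
  is_cderive (fun s => texp m.+1 (s%:C * z)) t (z * texp m (t%:C * z)).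
Proof.
elim: m => [|m IH].
  under eq_fun do rewrite texpS texp0 add0r expr0.
  rewrite texp0 mulr0; exact: is_cderive_cst.
under eq_fun do rewrite texpS.
apply: is_cderive_eq.
  apply: is_cderiveD IH _; apply: is_cderiveM (is_cderive_cst _ _).
  apply: is_cderiveX; exact: is_cderiveM (is_cderive_id _) (is_cderive_cst _ _).
rewrite !(mulr0, addr0, mul1r) [in RHS]texpS mulrDr; congr (_ + _).
rewrite factS natrM invfM /= mulrACA.
have : m`!%:R != 0 :> R[i] by rewrite pnatr_eq0 -lt0n fact_gt0.
have : m.+1%:R != 0 :> R[i] by rewrite pnatr_eq0.
move: (m.+1%:R) (m`!%:R) => a b a0 b0; field; exact/andP.
Qed.

Lemma is_cderive_rexp m z t :
  is_cderive (fun s => rexp m.+1 (s%:C * z)) t (z * rexp m (t%:C * z)).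
Proof.
rewrite /rexp mulrBr.
have H : is_cderive (fun s => cexp (s%:C * z)) t (z * cexp (t%:C * z)).
  apply: is_cderive_eq.
    apply: is_cderive_cexp.
    exact: is_cderiveM (is_cderive_id _) (is_cderive_cst _ _).
  by rewrite mulr0 addr0 mul1r.
have := is_cderiveD H (is_cderiveM (is_cderive_cst (-1) t) (is_cderive_texp m z t)).
rewrite mul0r add0r mulN1r.
by under eq_fun do rewrite mulN1r.
Qed.

(** Induction along the segment from 0 to z: the remainder of order m+1 vanishes at s = 0, and its
    derivative in s is z times the remainder of order m. *)
Lemma rexp_seg m z s : 0 <= s <= 1 ->
  normc (rexp m (s%:C * z)) <=
    (2 * normc z) ^+ m * expR (normc z) / m`!%:R * s ^+ m.
Proof.
elim: m s => [|m IH] s s01.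
  rewrite /rexp texp0 subr0 normc_cexp !expr0 mul1r mulr1 fact0 divr1 ler_expR.
  case/andP: s01 => s0 s1; rewrite (le_trans (ler_norm _))//.
  rewrite (le_trans (normRe_le _))// Normc.normcM normc_real ger0_norm//.
  by rewrite ler_piMl// normc_ge0.
pose c := normc z * ((2 * normc z) ^+ m * expR (normc z) / m`!%:R).
have H t : 0 <= t <= 1 -> normc (z * rexp m (t%:C * z)) <= c * t ^+ m.
  by move=> t01; rewrite Normc.normcM -mulrA ler_wpM2l ?normc_ge0// IH.
have H0 : rexp m.+1 (0%:C * z) = 0.
  by rewrite mul0r /rexp cexp0 texp_at0 subrr.
(* Bounding the real and imaginary parts separately costs the factor 2. *)
rewrite (le_trans (normc_le _))//.
have -> : (2 * normc z) ^+ m.+1 * expR (normc z) / m.+1`!%:R * s ^+ m.+1 =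
    c / m.+1%:R * s ^+ m.+1 + c / m.+1%:R * s ^+ m.+1.
  rewrite /c factS natrM invfM !exprS.
  have : m`!%:R != 0 :> R by rewrite pnatr_eq0 -lt0n fact_gt0.
  have : m.+1%:R != 0 :> R by rewrite pnatr_eq0.
  by move: (m.+1%:R) (m`!%:R) => a b a0 b0; field; exact/andP.
apply: lerD.
- apply: (monomial_majorant _ (fun t => (is_cderive_rexp m z t).1)) s01.
    by rewrite H0.
  by move=> t t01; exact: le_trans (normRe_le _) (H t t01).
- apply: (monomial_majorant _ (fun t => (is_cderive_rexp m z t).2)) s01.
    by rewrite H0.
  by move=> t t01; exact: le_trans (normIm_le _) (H t t01).
Qed.

Lemma rexp_le m z :
  normc (rexp m z) <= (2 * normc z) ^+ m * expR (normc z) / m`!%:R.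
Proof.
have /(_ 1) := @rexp_seg m z; rewrite mul1r expr1n mulr1; apply.
by rewrite ler01 lexx.
Qed.

Lemma expn_fact_cvg0 (x e : R) : 0 < e ->
  exists m : nat, (0 < m)%N /\ x ^+ m / m`!%:R <= e.
Proof.
move=> e0.
have /cvg_series_cvg_0/cvgr0Pnorm_lt/(_ _ e0)[N _ HN] :=
  @is_cvg_series_exp_coeff R x.
exists N.+1; split => //.
by have /ltW := HN N.+1 (leqnSn _); exact/le_trans/ler_norm.
Qed.

End taylor_remainder.

(** * Integration on ]0, 2pi[ *)

Section integrals_on_Omega.
Context {R : realType}.
Implicit Types (f g u v : R -> R) (c : R).

Lemma twopi_gt0 : 0 < 2 * pi :> R.
Proof. by rewrite mulr_gt0// pi_gt0. Qed.

Lemma measurable_Omega : measurable (@Omega R : set (measurableTypeR R)).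
Proof. exact: measurable_itv. Qed.
#[local] Hint Resolve measurable_Omega : core.

Lemma Omega_sub : @Omega R `<=` ccI.
Proof. exact: subset_itv_oo_cc. Qed.

Lemma OmegaE (x : R) : Omega x = (0 < x < 2 * pi) :> Prop.
Proof. by rewrite /Omega /= in_itv. Qed.

Lemma Omega_finite : (mu (@Omega R) < +oo)%E.
Proof. by rewrite lebesgue_measure_itv/=; case: ifP => // _; rewrite -EFinB ltry. Qed.

Definition rint f := mu.-integrable (@Omega R) (EFin \o f).

Lemma rint_eq f g : (forall x, Omega x -> f x = g x) -> rint f -> rint g.
Proof.
by move=> fg; apply: eq_integrable => // x /set_mem xO /=; rewrite fg.
Qed.

Lemma rint_measurable f : rint f -> rmeas f.
Proof. by move=> /measurable_int/measurable_EFinP. Qed.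

Lemma rintD f g : rint f -> rint g -> rint (fun x => f x + g x).
Proof. move=> rf rg; have := integrableD measurable_Omega rf rg.
by apply: eq_integrable => // x _ /=; rewrite EFinD. Qed.

Lemma rintZ c f : rint f -> rint (fun x => c * f x).
Proof. move=> rf; have := integrableZl measurable_Omega c rf.
by apply: eq_integrable => // x _ /=; rewrite EFinM. Qed.

Lemma rintN f : rint f -> rint (fun x => - f x).
Proof. by move=> /(rintZ (-1)); apply: rint_eq => x _; rewrite mulN1r. Qed.

Lemma rintB f g : rint f -> rint g -> rint (fun x => f x - g x).
Proof. by move=> rf /rintN; exact: rintD. Qed.

Lemma rint_le f g : rmeas f -> rint g ->
  (forall x, Omega x -> `|f x| <= `|g x|) -> rint f.
Proof.
move=> mf rg fg; apply: (le_integrable _ _ _ rg) => //.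
by apply/measurable_EFinP.
Qed.

Lemma rint_cst c : rint (fun=> c).
Proof.
apply: measurable_bounded_integrable => //; first exact: Omega_finite.
exact: bounded_cst.
Qed.

Definition rcont u := {within ccI, continuous u}.

Lemma rcont_measurable u : rcont u -> rmeas u.
Proof.
move=> cu; apply: (@measurable_funS _ _ _ _ ccI) => //; first exact: Omega_sub.
exact: subspace_continuous_measurable_fun.
Qed.

Lemma rcont_bounded u : rcont u -> exists M, 0 < M /\ forall x, ccI x -> `|u x| <= M.
Proof.
move=> cu; have [M [Mr MP]] :=
  compact_bounded (continuous_compact cu (@segment_compact R 0 (2 * pi))).
exists (`|M| + 1); split=> [|x xI]; first by rewrite ltr_wpDl.
apply: MP; last by exists x.
by rewrite ltr_pwDr// ler_norm.
Qed.

Lemma rint_contM u f : rcont u -> rint f -> rint (fun x => u x * f x).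
Proof.
move=> cu rf; have [M [M0 uM]] := rcont_bounded cu.
apply: (@rint_le _ (fun x => M * f x)).
- apply: measurable_funM; [exact: rcont_measurable|exact: rint_measurable].
- exact: rintZ.
- move=> x xO; rewrite !normrM ler_wpM2r// (le_trans _ (ler_norm _))//.
  by rewrite uM//; exact: Omega_sub.
Qed.

Lemma rcont_rint u : rcont u -> rint u.
Proof.
by move=> /rint_contM/(_ (rint_cst 1)); apply: rint_eq => x _; rewrite mulr1.
Qed.

Lemma rcontD u v : rcont u -> rcont v -> rcont (fun x => u x + v x).
Proof. by move=> cu cv x; apply: continuousD; [exact: cu|exact: cv]. Qed.

Lemma rcontM u v : rcont u -> rcont v -> rcont (fun x => u x * v x).
Proof. by move=> cu cv x; apply: continuousM; [exact: cu|exact: cv]. Qed.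

Lemma rcont_cst c : rcont (fun=> c).
Proof. by move=> x; exact: cst_continuous. Qed.

Lemma rcontN u : rcont u -> rcont (fun x => - u x).
Proof. by move=> cu x; apply: continuousN; exact: cu. Qed.

Lemma rcont_is_derive u (u' : R -> R) : (forall x : R, is_derive x 1 u (u' x)) -> rcont u.
Proof.
move=> uu'; apply: continuous_subspaceT => t; apply: differentiable_continuous.
by apply/derivable1_diffP; have [] := uu' t.
Qed.


Lemma RintZ c f : rint f -> \int[mu]_(x in Omega) (c * f x) = c * Rint f.
Proof. by move=> rf; exact: RintegralZl. Qed.

Lemma RintD f g : rint f -> rint g ->
  \int[mu]_(x in Omega) (f x + g x) = Rint f + Rint g.
Proof. by move=> rf rg; exact: RintegralD. Qed.

Lemma RintB f g : rint f -> rint g ->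
  \int[mu]_(x in Omega) (f x - g x) = Rint f - Rint g.
Proof. by move=> rf rg; exact: RintegralB. Qed.

Lemma eq_Rint f g : (forall x, Omega x -> f x = g x) -> Rint f = Rint g.
Proof. by move=> fg; apply: eq_Rintegral => x /set_mem; exact: fg. Qed.

Lemma Rint0 : Rint (fun=> 0 : R) = 0.
Proof.
rewrite -[RHS](mul0r (Rint (fun=> 0 : R))) -RintZ; last exact: rint_cst.
by apply: eq_Rint => x _; rewrite mul0r.
Qed.

Lemma le_Rint f g : rint f -> rint g -> (forall x, Omega x -> f x <= g x) ->
  Rint f <= Rint g.
Proof. by move=> rf rg fg; apply: le_Rintegral. Qed.

Lemma rint_norm f : rint f -> rint (fun x => `|f x|).
Proof.
move=> rf; apply: (rint_le _ rf); last by move=> x _; rewrite normr_id.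
by apply: measurableT_comp => //; exact: rint_measurable.
Qed.

Lemma normr_Rint f g : rint f -> rint g -> (forall x, Omega x -> `|f x| <= g x) ->
  `|Rint f| <= Rint g.
Proof.
move=> rf rg fg; rewrite (le_trans (le_normr_Rintegral _ _))//.
by apply: le_Rint => //; exact: rint_norm.
Qed.

Lemma ae_Rint f g : rmeas f -> rmeas g ->
  ae_eq mu Omega f g -> Rint f = Rint g.
Proof.
move=> mf mg fg; congr fine; apply: ae_eq_integral => //.
- by apply/measurable_EFinP.
- by apply/measurable_EFinP.
- by apply: filterS fg => x /= fgx xO; rewrite fgx.
Qed.

End integrals_on_Omega.
#[local] Hint Resolve measurable_Omega : core.

(** * Complex integrals and square integrable functions *)

Section complex_integrals.
Context {R : realType}.
Implicit Types (f g u v : R -> R[i]) (c : R[i]).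

Definition cintble f := rint (fun x => Re (f x)) /\ rint (fun x => Im (f x)).

Definition ccont u := rcont (fun x => Re (u x)) /\ rcont (fun x => Im (u x)).

Lemma ccontD u v : ccont u -> ccont v -> ccont (fun x => u x + v x).
Proof.
move=> [u1 u2] [v1 v2]; split.
  by under eq_fun do rewrite ReD; exact: rcontD.
by under eq_fun do rewrite ImD; exact: rcontD.
Qed.

Lemma ccontM u v : ccont u -> ccont v -> ccont (fun x => u x * v x).
Proof.
move=> [u1 u2] [v1 v2]; split.
  by under eq_fun do rewrite ReM; apply: rcontD; [|apply: rcontN]; exact: rcontM.
by under eq_fun do rewrite ImM; apply: rcontD; exact: rcontM.
Qed.

Lemma ccont_cst c : ccont (fun=> c).
Proof. by split; exact: rcont_cst. Qed.

Lemma ccontB u v : ccont u -> ccont v -> ccont (fun x => u x - v x).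
Proof.
move=> cu cv; have := ccontD cu (ccontM (ccont_cst (-1)) cv).
by under eq_fun do rewrite mulN1r.
Qed.

Lemma ccontX u n : ccont u -> ccont (fun x => u x ^+ n).
Proof.
move=> cu; elim: n => [|n IH].
  by under eq_fun do rewrite expr0; exact: ccont_cst.
by under eq_fun do rewrite exprS; exact: ccontM.
Qed.

Lemma ccont_real (a : R -> R) : rcont a -> ccont (fun x => (a x)%:C).
Proof. by move=> ca; split => //; exact: rcont_cst. Qed.

Lemma ccont_cderive u (u' : R -> R[i]) : (forall x, is_cderive u x (u' x)) -> ccont u.
Proof.
move=> uu'; split.
  exact: (rcont_is_derive (fun x => (uu' x).1)).
exact: (rcont_is_derive (fun x => (uu' x).2)).
Qed.

Lemma is_cderive_cexpl c (x : R) :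
  is_cderive (fun t => cexp (c * t%:C)) x (c * cexp (c * x%:C)).
Proof.
apply: is_cderive_eq.
  apply: is_cderive_cexp.
  exact: is_cderiveM (is_cderive_cst _ _) (is_cderive_id _).
by rewrite mul0r add0r mulr1.
Qed.

Lemma ccont_cexpl c : ccont (fun t => cexp (c * t%:C)).
Proof. exact: (ccont_cderive (is_cderive_cexpl c)). Qed.

Lemma ccont_id : ccont (fun t : R => t%:C).
Proof. exact: (ccont_cderive (@is_cderive_id R)). Qed.

Lemma cintble_eq f g : (forall x, Omega x -> f x = g x) -> cintble f -> cintble g.
Proof.
by move=> fg [f1 f2]; split; [apply: rint_eq f1|apply: rint_eq f2] => x /fg ->.
Qed.

Lemma cintbleD f g : cintble f -> cintble g -> cintble (fun x => f x + g x).
Proof.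
move=> [u1 u2] [v1 v2]; split.
  by under eq_fun do rewrite ReD; exact: rintD.
by under eq_fun do rewrite ImD; exact: rintD.
Qed.

Lemma cintble_contM u f : ccont u -> cintble f -> cintble (fun x => u x * f x).
Proof.
move=> [u1 u2] [v1 v2]; split.
  by under eq_fun do rewrite ReM; apply: rintB; exact: rint_contM.
by under eq_fun do rewrite ImM; apply: rintD; exact: rint_contM.
Qed.

Lemma cintbleZ c f : cintble f -> cintble (fun x => c * f x).
Proof. by apply: cintble_contM; exact: ccont_cst. Qed.

Lemma ccont_cintble u : ccont u -> cintble u.
Proof. by move=> [u1 u2]; split; exact: rcont_rint. Qed.

Lemma cintE f : cintegral f = Rint (fun x => Re (f x)) +i* Rint (fun x => Im (f x)).
Proof. by []. Qed.

Lemma eq_cint f g : (forall x, Omega x -> f x = g x) -> cintegral f = cintegral g.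
Proof.
move=> fg; rewrite !cintE; congr (_ +i* _); apply: eq_Rint => x /fg -> //.
Qed.

Lemma cint0 : cintegral (fun=> 0 : R[i]) = 0.
Proof. by rewrite cintE; apply: complexP; rewrite !ReImE Rint0. Qed.

Lemma cintD f g : cintble f -> cintble g ->
  cintegral (fun x => f x + g x) = cintegral f + cintegral g.
Proof.
move=> [f1 f2] [g1 g2]; rewrite !cintE; apply: complexP; rewrite !ReImE -RintD//;
  by apply: eq_Rint => x _; rewrite !ReImE.
Qed.

Lemma cintZ c f : cintble f -> cintegral (fun x => c * f x) = c * cintegral f.
Proof.
move=> [f1 f2]; rewrite !cintE; apply: complexP; rewrite !ReImE -!RintZ//.
  by rewrite -RintB; [apply: eq_Rint => x _; rewrite !ReImE|exact: rintZ..].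
by rewrite -RintD; [apply: eq_Rint => x _; rewrite !ReImE|exact: rintZ..].
Qed.

Lemma cintN f : cintble f -> cintegral (fun x => - f x) = - cintegral f.
Proof.
by move=> cf; rewrite -mulN1r -cintZ//; apply: eq_cint => x _; rewrite mulN1r.
Qed.

Lemma cintB f g : cintble f -> cintble g ->
  cintegral (fun x => f x - g x) = cintegral f - cintegral g.
Proof.
move=> cf cg; rewrite -cintN// -cintD//.
by have := cintbleZ (-1) cg; apply: cintble_eq => x _; rewrite mulN1r.
Qed.

(** The factor 2 is the price of bounding the real and imaginary parts separately. *)
Lemma normc_cint f (g : R -> R) : cintble f -> rint g ->
  (forall x, Omega x -> normc (f x) <= g x) -> normc (cintegral f) <= 2 * Rint g.
Proof.
move=> [f1 f2] rg fg; rewrite (le_trans (normc_le _))// mulr_natl mulr2n.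
apply: lerD; apply: normr_Rint => // x /fg; apply: le_trans.
  exact: normRe_le.
exact: normIm_le.
Qed.

Lemma ae_cint f g : cintble f -> cintble g -> eqL2 f g -> cintegral f = cintegral g.
Proof.
move=> [f1 f2] [g1 g2] fg; rewrite !cintE; congr (_ +i* _); apply: ae_Rint;
  try exact: rint_measurable.
  by apply: filterS fg => x /= fgx /fgx ->.
by apply: filterS fg => x /= fgx /fgx ->.
Qed.

Lemma sqnormc_ge0 c : 0 <= sqnormc c.
Proof. by rewrite sqnormcE sqr_ge0. Qed.

Lemma normc_sqnormc c : normc c <= 1 + sqnormc c.
Proof. by rewrite sqnormcE; have := normc_ge0 c; nra. Qed.

(* A majorant of |f| that is integrable as soon as f is in L^2. *)
Definition Lmaj f x := 1 + sqnormc (f x).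

Lemma Lmaj_ge0 f x : 0 <= Lmaj f x.
Proof. by rewrite addr_ge0// sqnormc_ge0. Qed.

Lemma L2_Lmaj f : L2 f -> rint (Lmaj f).
Proof. by move=> [_ _ fi]; apply: rintD => //; exact: rint_cst. Qed.

Lemma L2_cintble f : L2 f -> cintble f.
Proof.
move=> fL; have fm := L2_Lmaj fL; have [m1 m2 _] := fL.
split; [apply: rint_le m1 fm _|apply: rint_le m2 fm _] => x _;
  rewrite [leRHS]ger0_norm ?Lmaj_ge0//.
  exact: le_trans (normRe_le _) (normc_sqnormc _).
exact: le_trans (normIm_le _) (normc_sqnormc _).
Qed.

Lemma L2_le f (g : R -> R) : cintble f -> rint g ->
  (forall x, Omega x -> sqnormc (f x) <= g x) -> L2 f.
Proof.
move=> [/rint_measurable m1 /rint_measurable m2] rg fg; split => //.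
apply: (rint_le _ rg) => [|x xO]; last first.
  by rewrite ger0_norm ?sqnormc_ge0// (le_trans (fg x xO))// ler_norm.
by apply: measurable_funD; apply: measurable_funX.
Qed.

Lemma L2D f g : L2 f -> L2 g -> L2 (fun x => f x + g x).
Proof.
move=> fL gL; apply: (@L2_le _ (fun x => 2 * (sqnormc (f x) + sqnormc (g x)))).
- by apply: cintbleD; exact: L2_cintble.
- by apply: rintZ; apply: rintD; [case: fL|case: gL].
- move=> x _; rewrite /sqnormc !ReImE.
  set a := Re _; set b := Im _; set p := Re _; set q := Im _.
  have := sqr_ge0 (a - p); have := sqr_ge0 (b - q); nra.
Qed.

Lemma ccont_bounded u : ccont u -> exists M, 0 < M /\ forall x, ccI x -> normc (u x) <= M.
Proof.
move=> [/rcont_bounded[M1 [M10 u1]] /rcont_bounded[M2 [M20 u2]]].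
exists (M1 + M2); split => [|x xI]; first exact: addr_gt0.
by rewrite (le_trans (normc_le _))// lerD ?u1 ?u2.
Qed.

Lemma L2_contM u f : ccont u -> L2 f -> L2 (fun x => u x * f x).
Proof.
move=> cu fL; have [M [M0 uM]] := ccont_bounded cu.
apply: (@L2_le _ (fun x => M ^+ 2 * sqnormc (f x))).
- by apply: cintble_contM => //; exact: L2_cintble.
- by apply: rintZ; case: fL.
- move=> x xO; rewrite !sqnormcE Normc.normcM exprMn ler_wpM2r ?sqr_ge0//.
  by rewrite ler_pXn2r// ?nnegrE ?normc_ge0 ?(ltW M0)// uM//; exact: Omega_sub.
Qed.

Lemma L2Z c f : L2 f -> L2 (fun x => c * f x).
Proof. by apply: L2_contM; exact: ccont_cst. Qed.

Lemma L2_ccont u : ccont u -> L2 u.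
Proof.
move=> cu; have [M [M0 uM]] := ccont_bounded cu.
apply: (@L2_le _ (fun x => M ^+ 2)); [exact: ccont_cintble|exact: rint_cst|].
move=> x xO; rewrite sqnormcE ler_pXn2r// ?nnegrE ?normc_ge0 ?(ltW M0)//.
by rewrite uM//; exact: Omega_sub.
Qed.

End complex_integrals.

(** * Primitives and weak derivatives *)

Section fubini_triangle.
Context {R : realType}.
Implicit Types (a b : measurableTypeR R -> R).
Local Notation T := (measurableTypeR R).
Local Notation lam := (@lebesgue_measure R).

Let tri : set (T * T) := [set z | z.2 <= z.1].

Let measurable_tri : measurable tri.
Proof.
have /(_ measurableT [set true]) : measurable_fun setT (fun z : T * T => z.2 <= z.1).
  by apply: measurable_fun_ler.
by rewrite setTI => /(_ I); congr measurable; apply/seteqP; split => z.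
Qed.

(** Fubini for a(x) b(t) on the half plane t <= x, dominated by |a(x)| |b(t)|. It serves as
    integration by parts when [b] is merely integrable. *)
Lemma fubini_triangle a b :
  lam.-integrable setT (EFin \o a) -> lam.-integrable setT (EFin \o b) ->
  \int[lam]_x (a x * \int[lam]_(t in [set t | t <= x]) b t) =
  \int[lam]_t (b t * \int[lam]_(x in [set x | t <= x]) a x).
Proof.
move=> ia ib.
have ma : measurable_fun setT a by apply/measurable_EFinP/measurable_int/ia.
have mb : measurable_fun setT b by apply/measurable_EFinP/measurable_int/ib.
pose h (z : T * T) : \bar R := (a z.1 * b z.2 * \1_tri z)%:E.
have mh : measurable_fun setT h.
  apply/measurable_EFinP; apply: measurable_funM.
    apply: measurable_funM.
      exact: measurableT_comp ma measurable_fst.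
    exact: measurableT_comp mb measurable_snd.
  exact: measurable_indic.
have ih : (lam \x lam)%E.-integrable setT h.
  apply/(integrable12ltyP _ _ mh).
  have mk (x : T) (c : R) : measurable_fun setT (fun y => `|(c * b y)%:E|)%E.
    by apply: measurableT_comp => //; apply/measurable_EFinP; exact: measurable_funM.
  have ib' : (\int[lam]_y `|(b y)%:E| < +oo)%E by case/integrableP : ib.
  have ab x : (\int[lam]_y `|h (x, y)| <= `|(a x)%:E| * \int[lam]_y `|(b y)%:E|)%E.
    rewrite -ge0_integralZl//; last first.
      by apply: measurableT_comp => //; apply/measurable_EFinP.
    apply: ge0_le_integral => //.
    - apply: measurableT_comp => //.
      exact: (measurableT_comp mh (pair1_measurable x)).
    - by under eq_fun do rewrite -abseM -EFinM; exact: mk.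
    - move=> y _; rewrite /h/= lee_fin !normrM -[leRHS]mulr1 ler_wpM2l ?mulr_ge0//.
      by rewrite indicE; case: (_ \in _); rewrite ?normr1 ?normr0.
  apply: (@le_lt_trans _ _ (\int[lam]_x (`|(a x)%:E| * \int[lam]_y `|(b y)%:E|))%E).
    apply: ge0_le_integral => //.
    - by move=> x _; exact: integral_ge0.
    - apply: (measurable_fun_fubini_tonelli_F (abse \o h)) => //=.
      exact: measurableT_comp.
    - apply: emeasurable_funM => //.
      by apply: measurableT_comp => //; apply/measurable_EFinP.
  rewrite ge0_integralZr//; last 2 first.
    by apply: measurableT_comp => //; apply/measurable_EFinP.
    exact: integral_ge0.
  case/integrableP : ia => _ ia'; apply: lte_mul_pinfty => //.
    exact: integral_ge0.
  by rewrite ge0_fin_numE// integral_ge0.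
have := Fubini ih.
have inner (u : T -> R) (c : R) (D : set T) : measurable D ->
    lam.-integrable setT (EFin \o u) ->
    (\int[lam]_y (c * (u y * \1_D y))%:E = (c * \int[lam]_(y in D) u y)%:E)%E.
  move=> mD iu; have iuD : lam.-integrable D (EFin \o u).
    exact: integrableS iu.
  under eq_integral do rewrite EFinM.
  rewrite integralZl//; last first.
    apply: (le_integrable _ _ _ iu) => //.
      apply/measurable_EFinP; apply: measurable_funM; last exact: measurable_indic.
      by apply/measurable_EFinP/measurable_int/iu.
    move=> y _ /=; rewrite lee_fin normrM -[leRHS]mulr1 ler_wpM2l//.
    by rewrite indicE; case: (_ \in _); rewrite ?normr1 ?normr0.
  rewrite EFinM; congr (_ * _)%E.
  rewrite /Rintegral fineK; last exact: integrable_fin_num.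
  rewrite [RHS]integral_mkcond; apply: eq_integral => y _.
  by rewrite patchE indicE; case: (_ \in _); rewrite ?mulr1 ?mulr0.
have mle (x : R) : measurable ([set t | t <= x] : set T).
  by rewrite -set_itvNyc; exact: measurable_itv.
have mge (x : R) : measurable ([set t | x <= t] : set T).
  by rewrite -set_itvcy; exact: measurable_itv.
have E1 x : (\int[lam]_y h (x, y) = (a x * \int[lam]_(t in [set t | t <= x]) b t)%:E)%E.
  rewrite -inner//.
  by apply: eq_integral => y _; rewrite /h /= mulrA.
have E2 y : (\int[lam]_x h (x, y) = (b y * \int[lam]_(t in [set t | y <= t]) a t)%:E)%E.
  rewrite -inner//.
  by apply: eq_integral => x _; rewrite /h /= [a x * _]mulrC mulrA.
under eq_integral do rewrite E1.
under [RHS]eq_integral do rewrite E2.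
by rewrite /Rintegral => ->.
Qed.
End fubini_triangle.

Section primitive.
Context {R : realType}.
Implicit Types (f g phi : R -> R).
Local Notation T := (measurableTypeR R).

Lemma restrict_integrable f : rint f ->
  (@lebesgue_measure R).-integrable setT (EFin \o (f \_ Omega)).
Proof.
by move=> rf; rewrite -restrict_EFin; exact: (integrable_mkcond _ measurable_Omega).1.
Qed.

Lemma FTC_derivable f (f' : R -> R) a b : a <= b ->
  (forall x : R, is_derive x 1 f (f' x)) -> {within `[a, b], continuous f'} ->
  \int[mu]_(x in `[a, b]) f' x = f b - f a.
Proof.
move=> + ff' cf'; rewrite le_eqVlt => /predU1P[->|ab].
  by rewrite set_itv1 Rintegral_set1 subrr.
rewrite /Rintegral (@continuous_FTC2 _ f' f)//.
- have cf : continuous f.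
    move=> x; apply: differentiable_continuous; apply/derivable1_diffP.
    by have [] := ff' x.
  split.
  + by move=> x _; have [] := ff' x.
  + exact/cvg_at_right_filter/cf.
  + exact/cvg_at_left_filter/cf.
- by move=> x _; rewrite derive1E; have [_ ->] := ff' x.
Qed.

Definition prim g x := \int[mu]_(t in `[0, x]) (g \_ Omega) t.

Lemma prim_cont g : rint g -> rcont (prim g).
Proof.
move=> rg; apply: parameterized_integral_continuous; first exact/ltW/twopi_gt0.
apply: integrableS (restrict_integrable rg) => //.
Qed.

Lemma prim_at0 g : prim g 0 = 0.
Proof. by rewrite /prim set_itv1 Rintegral_set1. Qed.

Lemma prim_twopi g : prim g (2 * pi) = Rint g.
Proof.
rewrite /prim -Rintegral_mkcondr; congr Rintegral.
by rewrite setIidr//; exact: Omega_sub.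
Qed.

(** Extension by zero turns the primitive into an integral over a half line, the form that
    [fubini_triangle] asks for. *)
Lemma prim_le g (x : R) : \int[mu]_(t in [set t | t <= x]) (g \_ Omega) t = prim g x.
Proof.
rewrite /prim -!Rintegral_mkcondr; congr Rintegral; apply/seteqP; split => t /=.
  rewrite !OmegaE in_itv/= => -[tx /andP[t0 t1]]; split; last by rewrite t0.
  by rewrite tx ltW.
by rewrite in_itv/= => -[/andP[_ ->]].
Qed.

End primitive.

Section test_functions.
Context {R : realType}.
Implicit Types (f g phi : R -> R).

Lemma Rint_cc f : rcont f -> \int[mu]_(x in ccI) f x = Rint f.
Proof.
move=> cf.
have fi : (@lebesgue_measure R).-integrable ccI (EFin \o f).
  by apply: continuous_compact_integrable => //; exact: segment_compact.
rewrite -Rintegral_itv_bndo_bndc.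
  rewrite -Rintegral_itv_obnd_cbnd//.
  by apply: integrableS fi => //; exact: subset_itv_oo_cc.
by apply: integrableS fi => //; exact: subset_itv_co_cc.
Qed.

Lemma test_is_derive phi (x : R) : test_function phi -> is_derive x 1 phi (derive1 phi x).
Proof. by move=> [d _ _]; rewrite derive1E; exact: derivableP. Qed.

Lemma test_continuous phi : test_function phi -> continuous phi.
Proof.
move=> [d _ _] x; apply: differentiable_continuous; exact/derivable1_diffP.
Qed.

Lemma test_rcont phi : test_function phi -> rcont phi.
Proof. by move=> t; apply: continuous_subspaceT; exact: test_continuous. Qed.

Lemma test_rcont1 phi : test_function phi -> rcont (derive1 phi).
Proof. by move=> [_ c _]; exact: continuous_subspaceT. Qed.

Lemma test_le0 phi x : test_function phi -> x <= 0 -> phi x = 0.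
Proof.
move=> [_ _ [a [b [a0 _ out]]]] x0; apply: out => /andP[ax _].
by move: (lt_le_trans a0 (le_trans ax x0)); rewrite ltxx.
Qed.

Lemma test_ge phi x : test_function phi -> 2 * pi <= x -> phi x = 0.
Proof.
move=> [_ _ [a [b [_ b0 out]]]] x0; apply: out => /andP[_ xb].
by move: (lt_le_trans b0 (le_trans x0 xb)); rewrite ltxx.
Qed.

Lemma test_mul (a a' : R -> R) phi : (forall x : R, is_derive x 1 a (a' x)) ->
  continuous a' -> test_function phi ->
  test_function (fun x => a x * phi x) /\
  derive1 (fun x => a x * phi x) = (fun x => a' x * phi x + a x * derive1 phi x).
Proof.
move=> aa' ca' tphi.
have D (x : R) : is_derive x 1 (fun x => a x * phi x) (a' x * phi x + a x * derive1 phi x).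
  by apply: is_derive_mul => //; exact: test_is_derive.
have D1 : derive1 (fun x => a x * phi x) = (fun x => a' x * phi x + a x * derive1 phi x).
  by apply/funext => x; rewrite derive1E; have [_ ->] := D x.
split=> //; split.
- by move=> x; have [] := D x.
- rewrite D1 => x; apply: cvgD; apply: cvgM.
  + exact: ca'.
  + exact: test_continuous.
  + apply: differentiable_continuous; apply/derivable1_diffP.
    by have [] := aa' x.
  + by case: tphi => _ c _; exact: c.
- have [_ _ [p [q [p0 q0 out]]]] := tphi.
  by exists p, q; split=> // x /out ->; rewrite mulr0.
Qed.

(** [fubini_triangle] applied to phi' and g: the inner integral of phi' from t to 2 pi is - phi t,
    because phi vanishes at 2 pi. *)
Lemma prim_by_parts g phi : rint g -> test_function phi ->
  Rint (fun x => prim g x * derive1 phi x) = - Rint (fun x => g x * phi x).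
Proof.
move=> rg tphi.
have ia : (@lebesgue_measure R).-integrable setT (EFin \o (derive1 phi \_ ccI)).
  rewrite -restrict_EFin; apply: (integrable_mkcond _ _).1; first exact: measurable_itv.
  by apply: continuous_compact_integrable; [exact: segment_compact|exact: test_rcont1].
have E := fubini_triangle ia (restrict_integrable rg).
rewrite -Rint_cc; last by apply: rcontM; [exact: prim_cont|exact: test_rcont1].
rewrite Rintegral_mkcond.
under eq_Rintegral => x _.
  have -> : ((fun x => prim g x * derive1 phi x) \_ ccI) x =
      (derive1 phi \_ ccI) x * \int[mu]_(t in [set t | t <= x]) (g \_ Omega) t.
    by rewrite prim_le !patchE; case: ifP => _; rewrite ?mul0r// mulrC.
  over.
rewrite E -mulN1r -RintZ; last first.
  by apply: rint_eq (rint_contM (test_rcont tphi) rg) => x _; rewrite mulrC.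
rewrite [RHS]Rintegral_mkcond; apply: eq_Rintegral => t _; rewrite !patchE.
case: ifP => tO; last by rewrite mul0r.
move: tO; rewrite inE OmegaE => /andP[t0 t1].
rewrite mulrCA mulN1r; congr (_ * _).
have -> : - phi t = phi (2 * pi) - phi t by rewrite (test_ge tphi (lexx _)) sub0r.
have c' : {within `[t, 2 * pi], continuous (derive1 phi)}.
  by case: tphi => _ c _; exact: continuous_subspaceT.
rewrite -(FTC_derivable (ltW t1) (fun x => test_is_derive x tphi) c').
rewrite -Rintegral_mkcondr; congr Rintegral; apply/seteqP; split => x /=;
  rewrite !in_itv/=.
  by move=> [-> /andP[_ ->]].
move=> /andP[tx ->]; split=> //; rewrite andbT; exact: le_trans (ltW t0) tx.
Qed.

End test_functions.

Section vanishing.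
Context {R : realType}.
Implicit Types (f u w phi : R -> R).

Lemma rcont_dist u x e : rcont u -> ccI x -> 0 < e ->
  exists2 d, 0 < d & forall y, ccI y -> `|x - y| < d -> `|u x - u y| < e.
Proof.
move=> /subspace_continuousP/(_ x) + xI e0 => /(_ xI)/cvgrPdist_lt/(_ _ e0).
rewrite near_withinE => /nbhs_ballP[d d0 dP].
by exists d => // y yI xy; apply: dP.
Qed.

(** A nonzero value at x, even at an end point, persists on an open subinterval of positive length,
    which no null set contains. *)
Lemma ae0_rcont u : rcont u -> ae_eq mu Omega u (fun=> 0) ->
  forall x, ccI x -> u x = 0.
Proof.
move=> cu [N [mN N0 uN]] x xI; apply/eqP/negPn/negP => ux.
have ux0 : 0 < `|u x| by rewrite normr_gt0.
have [d d0 dP] := rcont_dist cu xI ux0.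
have {}dP y : ccI y -> `|x - y| < d -> u y != 0.
  by move=> yI /(dP y yI); apply: contraTneq => ->; rewrite subr0 ltxx.
move: xI; rewrite /= in_itv/= => /andP[x0 x1].
pose a := Num.max 0 (x - d); pose b := Num.min (2 * pi) (x + d).
have ab : a < b.
  have p0 := @twopi_gt0 R.
  by rewrite gt_max !lt_min; apply/andP; split; apply/andP; split; lra.
have JN : `]a, b[ `<=` N.
  move=> y /=; rewrite in_itv/= gt_max lt_min => /andP[/andP[y0 y1] /andP[y2 y3]].
  apply: uN => /= /(_ _) H; have : u y = 0 by apply: H; rewrite OmegaE y0.
  apply/eqP/dP; first by rewrite /= in_itv/= !ltW.
  by rewrite ltr_distlC y1.
have : (mu (`]a, b[%classic : set (measurableTypeR R)) <= mu N)%E.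
  by apply: le_measure; rewrite ?inE.
rewrite N0 lebesgue_measure_itv/= lte_fin ab -EFinB lee_fin subr_le0.
by rewrite leNgt ab.
Qed.

Lemma Rint_eq0 f : rcont f -> (forall x, Omega x -> 0 <= f x) -> Rint f = 0 ->
  forall x, ccI x -> f x = 0.
Proof.
move=> cf f0 If; apply: ae0_rcont => //.
have mf : measurable_fun (@Omega R : set (measurableTypeR R)) (EFin \o f).
  by apply/measurable_EFinP; exact: rcont_measurable.
have : (\int[mu]_(x in Omega) `|(EFin \o f) x| = 0)%E.
  rewrite -(_ : \int[mu]_(x in Omega) (f x)%:E = 0)%E; last first.
    rewrite -[LHS]fineK ?integrable_fin_num//; first by congr EFin.
    exact: rcont_rint.
  by apply: eq_integral => x /set_mem xO /=; rewrite ger0_norm// f0.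
move/(ae_eq_integral_abs _ measurable_Omega mf).1.
by apply: filterS => x /= + xO => /(_ xO)[].
Qed.

End vanishing.

(** * Functions with vanishing weak derivative *)

Section du_bois_reymond.
Context {R : realType}.
Implicit Types (u w phi q : R -> R).

(** Projection of the line onto [0, 2 pi]. Composition with it extends a function continuous on the
    interval to the whole line, since test functions live on the line. *)
Definition clamp (t : R) : R := Num.max 0 (Num.min t (2 * pi)).

Lemma clamp_cc t : ccI (clamp t).
Proof.
have p0 := @twopi_gt0 R; rewrite /= in_itv/= /clamp le_max lexx /=.
by rewrite ge_max (ltW p0)/= ge_min lexx orbT.
Qed.

Lemma clamp_id t : ccI t -> clamp t = t.
Proof.
by rewrite /= in_itv/= /clamp => /andP[t0 t1]; rewrite min_l// max_r.
Qed.

Lemma clamp_dist s t : `|clamp s - clamp t| <= `|s - t|.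
Proof.
have p0 := @twopi_gt0 R; have := ler_norm (s - t); have := ler_norm (t - s).
rewrite distrC ler_norml; move: `|s - t| => N; rewrite /clamp.
case: (leP s (2 * pi)) => s1; case: (leP t (2 * pi)) => t1.
- by case: (leP 0 s) => s0; case: (leP 0 t) => t0 ? ?; apply/andP; split; lra.
- by case: (leP 0 s) => s0; rewrite (max_r (ltW p0)) => ? ?; apply/andP; split; lra.
- by case: (leP 0 t) => t0; rewrite (max_r (ltW p0)) => ? ?; apply/andP; split; lra.
- by rewrite (max_r (ltW p0)) => ? ?; apply/andP; split; lra.
Qed.

Lemma continuous_clamp u : rcont u -> continuous (u \o clamp).
Proof.
move=> cu t; apply/cvgrPdist_lt => e e0.
have [d d0 dP] := rcont_dist cu (clamp_cc t) e0.
apply/nbhs_ballP; exists d => //= s ts.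
by apply: dP; [exact: clamp_cc|exact: le_lt_trans (clamp_dist _ _) ts].
Qed.

(** The primitive starting at minus infinity vanishes to the left of [a]; the zero mean of q makes
    it vanish again to the right of [b]. *)
Lemma test_primitive q a b : continuous q -> 0 < a -> b < 2 * pi ->
  (forall x, ~ (a <= x <= b) -> q x = 0) -> Rint q = 0 ->
  exists2 phi, test_function phi & derive1 phi = q.
Proof.
move=> cq a0 b0 q0 Iq.
have qO x : ~ Omega x -> q x = 0.
  move=> xO; apply: q0 => /andP[ax xb]; apply: xO; rewrite OmegaE.
  by rewrite (lt_le_trans a0)//= (le_lt_trans xb).
have iq : (@lebesgue_measure R).-integrable setT (EFin \o q).
  have -> : q = q \_ Omega.
    apply/funext => x; rewrite patchE; case: ifPn => //.
    by rewrite notin_setE => /qO.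
  by apply: restrict_integrable; apply: rcont_rint; exact: continuous_subspaceT.
pose phi x := \int[mu]_(t in `]-oo, x]) q t.
have D (x : R) : derivable phi x 1 /\ derive1 phi x = q x.
  apply: (@continuous_FTC1 _ _ -oo%O _ (x + 1)); last exact: cq.
  - by rewrite ltrDl.
  - exact: integrableS iq.
  - by rewrite lt_neqAle leNye.
have D1 : derive1 phi = q by apply/funext => x; have [] := D x.
exists phi => //; split=> [x||].
- by have [] := D x.
- by rewrite D1.
- exists a, b; split => // x xab.
  have [xa|ax] := ltP x a.
    rewrite /phi (_ : \int[mu]_(t in _) _ = \int[mu]_(t in `]-oo, x]) (0 * q t)).
      by rewrite RintegralZl ?mul0r//; exact: integrableS iq.
    apply: eq_Rintegral => t; rewrite inE/= in_itv/= => tx.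
    rewrite mul0r q0// => /andP[at_ _].
    by have := lt_le_trans xa (le_trans at_ tx); rewrite ltxx.
  have bx : b < x by rewrite ltNge; apply/negP => xb; apply: xab; rewrite ax.
  rewrite /phi -[RHS]Iq Rintegral_mkcond [RHS]Rintegral_mkcond.
  apply: eq_Rintegral => t _; rewrite !patchE.
  case: ifPn => tx; case: ifPn => tO //.
    by rewrite qO//; move: tO; rewrite notin_setE.
  rewrite q0// => /andP[_ tb]; move: tx; rewrite notin_setE/= in_itv/=.
  by apply; exact: le_trans tb (ltW bx).
Qed.

Lemma du_bois_reymond_Omega u : rcont u ->
  (forall phi, test_function phi -> Rint (fun x => u x * derive1 phi x) = 0) ->
  forall x y, Omega x -> Omega y -> u x = u y.
Proof.
move=> cu u0 x y; wlog xy : x y / x <= y => [H xO yO|].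
  by have [xy|/ltW yx] := leP x y; [|apply/esym]; apply: H.
rewrite !OmegaE => /andP[x0 x1] /andP[y0 y1].
pose a := x / 2; pose b := (y + 2 * pi) / 2.
(* [w] is twice the positive part of [h]: a continuous bump, positive exactly on ]a, b[, an interval
   around x and y whose closure lies in ]0, 2 pi[. *)
pose h t := (t - a) * (b - t); pose w t := h t + `|h t|.
have w_ge0 t : 0 <= w t by rewrite /w addrC -lerBlDr sub0r -normrN ler_norm.
have w_out t : ~ (a <= t <= b) -> w t = 0.
  move=> tab; rewrite /w ler0_norm ?subrr// /h.
  have ab : a <= b by rewrite /a /b; lra.
  have [ta|at_] := ltP t a.
    by rewrite mulr_le0_ge0// ?subr_le0 ?subr_ge0 ?(ltW ta)// (le_trans (ltW ta)).
  have [tb|bt] := leP t b; first by rewrite at_ tb in tab.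
  by rewrite mulr_ge0_le0// ?subr_le0 ?subr_ge0 ?(ltW bt).
have w_gt0 t : a < t < b -> 0 < w t.
  move=> /andP[at_ tb]; have h0 : 0 < h t by rewrite mulr_gt0// subr_gt0.
  by rewrite /w gtr0_norm// addr_gt0.
have ch : continuous h.
  move=> t; apply: cvgM; apply: cvgB; (exact: cvg_cst || exact: cvg_id).
have cw : continuous w.
  by move=> t; apply: cvgD; [exact: ch|apply: cvg_norm; exact: ch].
have rw : rcont w by exact: continuous_subspaceT.
have W0 : Rint w != 0.
  have wx : 0 < w x by apply: w_gt0; rewrite /a /b; apply/andP; split; lra.
  apply/eqP => /(Rint_eq0 rw (fun t _ => w_ge0 t))/(_ x).
  rewrite /= in_itv/= !ltW//= => /(_ isT) wx0.
  by rewrite wx0 ltxx in wx.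
(* With m the mean of u for the weight w, (u - m) w is the derivative of a test
   function, so the integral of (u - m)^2 w vanishes. *)
pose m := Rint (fun t => u t * w t) / Rint w.
pose q t := (u (clamp t) - m) * w t.
have cq : continuous q.
  move=> t; apply: cvgM; last exact: cw.
  by apply: cvgB; [exact: (continuous_clamp cu)|exact: cvg_cst].
have qE t : Omega t -> q t = (u t - m) * w t.
  by move=> /Omega_sub tO; rewrite /q clamp_id.
have Iq : Rint q = 0.
  transitivity (Rint (fun t => u t * w t - m * w t)).
    by apply: eq_Rint => t /qE ->; rewrite mulrBl.
  rewrite RintB; [|exact/rcont_rint/rcontM|exact/rintZ/rcont_rint].
  by rewrite RintZ ?rcont_rint// /m divfK// subrr.
have [|||phi tphi phiq] := @test_primitive q a b cq _ _ _ Iq.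
- by rewrite /a; lra.
- by rewrite /b; lra.
- by move=> t /w_out wt; rewrite /q wt mulr0.
have rq : rcont q by exact: continuous_subspaceT.
have : Rint (fun t => (u t - m) ^+ 2 * w t) = 0.
  transitivity (Rint (fun t => u t * q t - m * q t)).
    by apply: eq_Rint => t /qE ->; ring.
  rewrite RintB; [|exact/rcont_rint/rcontM|exact/rintZ/rcont_rint].
  by rewrite RintZ ?rcont_rint// Iq mulr0 subr0 -phiq u0.
have rsq : rcont (fun t => (u t - m) ^+ 2 * w t).
  have um : rcont (fun t => u t - m) by apply: rcontD => //; exact: rcont_cst.
  by apply: rcontM => //; under eq_fun do rewrite expr2; exact: rcontM.
have sq0 t : Omega t -> 0 <= (u t - m) ^+ 2 * w t by rewrite mulr_ge0 ?sqr_ge0.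
move=> /(Rint_eq0 rsq sq0) Z.
have um t : a < t < b -> 0 < t < 2 * pi -> u t = m.
  move=> /w_gt0 wt; rewrite -OmegaE => tO; have /eqP := Z t (Omega_sub tO).
  by rewrite mulf_eq0 (gt_eqF wt) orbF sqrf_eq0 subr_eq0 => /eqP.
by rewrite !um ?x0 ?y0// /a /b; apply/andP; split; lra.
Qed.

Lemma du_bois_reymond u : rcont u ->
  (forall phi, test_function phi -> Rint (fun x => u x * derive1 phi x) = 0) ->
  forall x, ccI x -> u x = u 0.
Proof.
move=> cu u0; have pO : Omega (pi : R).
  by rewrite OmegaE; have := pi_gt0 R; lra.
have H x : ccI x -> u x = u pi.
  move=> xI; apply/eqP; rewrite -subr_eq0; apply/eqP.
  apply: (@ae0_rcont _ (fun x => u x - u pi)) xI.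
    by apply: rcontD => //; exact: rcont_cst.
  apply: aeW => {}x xO; apply/eqP; rewrite subr_eq0; apply/eqP.
  exact: du_bois_reymond_Omega.
by move=> x /H ->; rewrite [RHS]H//= in_itv/= lexx ltW ?twopi_gt0.
Qed.

End du_bois_reymond.

(** * Calculus of weak derivatives *)

Section weak_derivatives.
Context {R : realType}.
Implicit Types (f g h : R -> R[i]) (phi : R -> R) (c l : R[i]).

Lemma cintble_Mcont f u : cintble f -> ccont u -> cintble (fun x => f x * u x).
Proof.
move=> cf cu; apply: cintble_eq (cintble_contM cu cf) => x _; exact: mulrC.
Qed.

Lemma test_ccont phi : test_function phi -> ccont (fun x => (phi x)%:C).
Proof. by move=> tphi; apply: ccont_real; exact: test_rcont. Qed.

Lemma test_ccont1 phi : test_function phi -> ccont (fun x => (derive1 phi x)%:C).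
Proof. by move=> tphi; apply: ccont_real; exact: test_rcont1. Qed.

Lemma weak_derivativeD f1 g1 f2 g2 :
  cintble f1 -> cintble g1 -> cintble f2 -> cintble g2 ->
  weak_derivative f1 g1 -> weak_derivative f2 g2 ->
  weak_derivative (fun x => f1 x + f2 x) (fun x => g1 x + g2 x).
Proof.
move=> if1 ig1 if2 ig2 w1 w2 phi tphi.
have c0 := test_ccont tphi; have c1 := test_ccont1 tphi.
under eq_fun do rewrite mulrDl; under [in RHS]eq_fun do rewrite mulrDl.
rewrite !cintD; try exact: cintble_Mcont.
by rewrite w1// w2// opprD.
Qed.

Lemma weak_derivativeZ c f g : cintble f -> cintble g ->
  weak_derivative f g -> weak_derivative (fun x => c * f x) (fun x => c * g x).
Proof.
move=> cf cg w phi tphi.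
have c0 := test_ccont tphi; have c1 := test_ccont1 tphi.
under eq_fun do rewrite -mulrA; under [in RHS]eq_fun do rewrite -mulrA.
by rewrite !cintZ ?w ?mulrN//; exact: cintble_Mcont.
Qed.

Lemma weak_derivative_cst c : weak_derivative (fun=> c) (fun=> 0).
Proof.
move=> phi tphi; rewrite cintZ; last by apply: ccont_cintble; exact: test_ccont1.
have -> : cintegral (fun x => (derive1 phi x)%:C) = 0.
  rewrite cintE /=; have tc : {within ccI, continuous (derive1 phi)}.
    exact: test_rcont1.
  rewrite -Rint_cc//.
  rewrite (FTC_derivable (ltW twopi_gt0) (fun x => test_is_derive x tphi) tc).
  rewrite (test_ge tphi)// (test_le0 tphi)// subrr.
  by apply: complexP; rewrite !ReImE// Rint0.
rewrite mulr0 (eq_cint (g := fun=> 0)) => [|x _]; last by rewrite mul0r.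
by rewrite cint0 oppr0.
Qed.

Lemma weak_derivative_eq f g h : cintble g -> cintble h -> eqL2 g h ->
  weak_derivative f g -> weak_derivative f h.
Proof.
move=> cg ch gh w phi tphi; have c0 := test_ccont tphi.
rewrite w//; congr (- _); apply: ae_cint; try exact: cintble_Mcont.
by apply: filterS gh => x /= ghx xO; rewrite ghx.
Qed.

Definition cprim g x : R[i] :=
  prim (fun t => Re (g t)) x +i* prim (fun t => Im (g t)) x.

Lemma cprim_ccont g : cintble g -> ccont (cprim g).
Proof. by move=> [g1 g2]; split; exact: prim_cont. Qed.

Lemma cprim_at0 g : cprim g 0 = 0.
Proof. by rewrite /cprim !prim_at0. Qed.

Lemma cprim_twopi g : cprim g (2 * pi) = cintegral g.
Proof. by rewrite /cprim !prim_twopi. Qed.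

Lemma weak_derivative_cprim g : cintble g -> weak_derivative (cprim g) g.
Proof.
move=> [g1 g2] phi tphi; rewrite !cintE; apply: complexP; rewrite !ReImE.
  transitivity (Rint (fun x => prim (fun t => Re (g t)) x * derive1 phi x)).
    by apply: eq_Rint => x _; rewrite /cprim !ReImE mulr0 subr0.
  rewrite prim_by_parts//; congr (- _); apply: eq_Rint => x _.
  by rewrite !ReImE mulr0 subr0.
transitivity (Rint (fun x => prim (fun t => Im (g t)) x * derive1 phi x)).
  by apply: eq_Rint => x _; rewrite /cprim !ReImE mulr0 add0r.
rewrite prim_by_parts//; congr (- _); apply: eq_Rint => x _.
by rewrite !ReImE mulr0 add0r.
Qed.

Lemma weak_derivative0 f : ccont f -> weak_derivative f (fun=> 0) ->
  forall x, ccI x -> f x = f 0.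
Proof.
move=> [f1 f2] w x xI.
have {}w phi : test_function phi -> cintegral (fun x => f x * (derive1 phi x)%:C) = 0.
  move=> /w ->; rewrite (eq_cint (g := fun=> 0)) => [|y _]; last by rewrite mul0r.
  by rewrite cint0 oppr0.
apply: complexP.
  apply: (du_bois_reymond f1) => // phi /w; rewrite cintE => -[E _].
  rewrite -[RHS]E; apply: eq_Rint => y _.
  by rewrite ReM ReC ImC mulr0 subr0.
apply: (du_bois_reymond f2) => // phi /w; rewrite cintE => -[_ E].
rewrite -[RHS]E; apply: eq_Rint => y _.
by rewrite ImM ReC ImC mulr0 add0r.
Qed.

Lemma weak_derivative_primitive f g : ccont f -> cintble g -> weak_derivative f g ->
  forall x, ccI x -> f x = f 0 + cprim g x.
Proof.
move=> cf cg w x xI; have cG := cprim_ccont cg.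
have := @weak_derivative0 (fun x => f x + -1 * cprim g x).
have cG1 : ccont (fun x => -1 * cprim g x) by apply: ccontM => //; exact: ccont_cst.
move=> /(_ (ccontD cf cG1)).
have w0 : weak_derivative (fun x => f x + -1 * cprim g x) (fun=> 0).
  have := weak_derivativeD (ccont_cintble cf) cg (ccont_cintble cG1) (cintbleZ (-1) cg)
    w (weak_derivativeZ (-1) (ccont_cintble cG) cg (weak_derivative_cprim cg)).
  by under [X in weak_derivative _ X]eq_fun do rewrite mulN1r subrr.
move=> /(_ w0 x xI); rewrite cprim_at0 mulr0 addr0 mulN1r => /eqP.
by rewrite subr_eq => /eqP.
Qed.

Lemma cexpl_derive l :
  (forall x : R, is_derive x 1 (fun t => Re (cexp (l * t%:C))) (Re (l * cexp (l * x%:C)))) *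
  (forall x : R, is_derive x 1 (fun t => Im (cexp (l * t%:C))) (Im (l * cexp (l * x%:C)))).
Proof. by split=> x; have [] := is_cderive_cexpl l x. Qed.

Lemma continuous_cexpl l :
  continuous (fun x : R => Re (l * cexp (l * x%:C))) /\
  continuous (fun x : R => Im (l * cexp (l * x%:C))).
Proof.
have H (x : R) : is_cderive (fun t => l * cexp (l * t%:C)) x (l * (l * cexp (l * x%:C))).
  apply: is_cderive_eq.
    exact: is_cderiveM (is_cderive_cst _ _) (is_cderive_cexpl _ _).
  by rewrite mul0r add0r.
by split=> x; apply: differentiable_continuous; apply/derivable1_diffP;
  have [[? _] [? _]] := H x.
Qed.

(** The product rule, obtained by moving the exponential onto the test function. Test functions are
    real, so the hypothesis is used with Re(e) phi and Im(e) phi, and the two identities are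
    recombined with the factor i. *)
Lemma weak_derivative_cexpl l f g : cintble f -> cintble g -> weak_derivative f g ->
  weak_derivative (fun x => cexp (l * x%:C) * f x)
    (fun x => cexp (l * x%:C) * (g x + l * f x)).
Proof.
move=> cf cg w phi tphi.
have c0 := test_ccont tphi; have c1 := test_ccont1 tphi; have ce := ccont_cexpl l.
have [k1 k2] := continuous_cexpl l.
have [t1 d1] := test_mul (cexpl_derive l).1 k1 tphi.
have [t2 d2] := test_mul (cexpl_derive l).2 k2 tphi.
pose e x := cexp (l * x%:C).
have cl := ccont_cst l.
have E : cintegral (fun x => f x * (l * e x * (phi x)%:C + e x * (derive1 phi x)%:C)) =
    - cintegral (fun x => g x * (e x * (phi x)%:C)).
  have := congr2 (fun a b => a + ii * b) (w _ t1) (w _ t2).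
  rewrite mulrN -opprD d1 d2.
  rewrite -!cintZ; try by apply: cintble_Mcont => //; apply: ccont_real;
    try exact: test_rcont; rewrite -?d1 -?d2; exact: test_rcont1.
  rewrite -!cintD; try by do ?apply: cintbleZ; apply: cintble_Mcont => //; apply: ccont_real;
    try exact: test_rcont; rewrite -?d1 -?d2; exact: test_rcont1.
  move=> E; rewrite (eq_cint (g := fun x => f x * (Re (l * e x) * phi x +
     Re (e x) * derive1 phi x)%:C + ii * (f x * (Im (l * e x) * phi x +
     Im (e x) * derive1 phi x)%:C))).
    rewrite E; congr (- _); apply: eq_cint => x _.
    by rewrite mulrCA -mulrDr; congr (_ * _); apply: complexP; rewrite !ReImE; ring.
  move=> x _; rewrite mulrCA -mulrDr; congr (_ * _).
  by move: (l * e x) (e x) => p q; apply: complexP; rewrite !ReImE; ring.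
have i1 : cintble (fun x => f x * (l * e x * (phi x)%:C)).
  by apply: cintble_Mcont => //; apply: ccontM => //; exact: ccontM.
have i2 : cintble (fun x => g x * (e x * (phi x)%:C)).
  by apply: cintble_Mcont => //; exact: ccontM.
have i3 : cintble (fun x => f x * (e x * (derive1 phi x)%:C)).
  by apply: cintble_Mcont => //; exact: ccontM.
transitivity (- cintegral (fun x => g x * (e x * (phi x)%:C)) -
    cintegral (fun x => f x * (l * e x * (phi x)%:C))).
  rewrite -E -cintB//; last by apply: cintble_eq (cintbleD i1 i3) => x _; rewrite mulrDr.
  by apply: eq_cint => x _; rewrite /e; ring.
rewrite -opprD -cintD//; congr (- _); apply: eq_cint => x _; rewrite /e; ring.
Qed.

End weak_derivatives.

(** * The characteristic function *)

Section characteristic_function.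
Context {R : realType}.
Context (K : R -> R[i]) (hK : L2 K).
Implicit Types (l z : R[i]).

(** The Fourier transform of [K] at complex frequency; at an integer n it is 2 pi times the Fourier
    coefficient of index -n. *)
Definition Khat l := cintegral (fun t => cexp (ii * l * t%:C) * K t).

(* The solution of i f' + c K = l f with f(0) = c satisfies
   f(2pi) - c = c e^(-2 pi i l) Delta(l). *)
Definition Delta l := 1 - cexp (ii * l * (2 * pi)%:C) + ii * Khat l.

Let K_int : cintble K := L2_cintble hK.

Let cc0 : ccI (0 : R).
Proof. by rewrite /= in_itv/= lexx ltW// twopi_gt0. Qed.

Let cc2 : ccI (2 * pi : R).
Proof. by rewrite /= in_itv/= lexx ltW// twopi_gt0. Qed.

Lemma eK_int l : cintble (fun t => cexp (ii * l * t%:C) * K t).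
Proof. by apply: cintble_contM => //; exact: ccont_cexpl. Qed.

Lemma eigenvalue_Delta0 l : eigenvalues (P1 K) l -> Delta l = 0.
Proof.
move=> [f [g [[[fH1 f02] gL [f' [f'L wf gE]]] gl f0]]].
have [cf1 cf2 _ _] := fH1.
have cf : ccont f by [].
pose c := f (2 * pi).
pose h x := cexp (ii * l * x%:C) * f x.
have ch : ccont h by apply: ccontM => //; exact: ccont_cexpl.
have kint := cintbleZ (ii * c) (eK_int l).
have wh : weak_derivative h (fun x => ii * c * (cexp (ii * l * x%:C) * K x)).
  have i1 := L2_cintble f'L; have i2 := ccont_cintble cf.
  apply: weak_derivative_eq (weak_derivative_cexpl (ii * l) i2 i1 wf) => //.
    apply: cintble_contM; first exact: ccont_cexpl.
    by apply: cintbleD => //; exact: cintbleZ.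
  apply: filterS2 gE gl => x gx1 gx2 xO.
  have := gx1 xO; rewrite (gx2 xO) -/c => E.
  have -> : f' x + ii * l * f x = ii * c * K x.
    have -> : ii * l * f x = ii * (l * f x) by ring.
    rewrite E mulrDr mulrA mulII mulN1r addrA subrr add0r; ring.
  ring.
have h0 : h 0 = c by rewrite /h mulr0 cexp0 mul1r f02.
(* With c = 0 the weak derivative of [h] is 0, so [h] is constantly h 0 = c = 0 and f vanishes,
   against the choice of f. *)
have c0 : c != 0.
  apply/eqP => c0; apply: f0; apply: aeW => x /Omega_sub xO.
  have wh0 : weak_derivative h (fun=> 0).
    by under eq_fun do rewrite -(mul0r (ii * 0 * 0)); move: wh; rewrite c0 mulr0;
       under [X in weak_derivative _ X -> _]eq_fun do rewrite mul0r;
       under [X in _ -> weak_derivative _ X]eq_fun do rewrite mul0r.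
  have /eqP := weak_derivative0 ch wh0 xO.
  by rewrite h0 c0 mulf_eq0 (negbTE (cexp_neq0 _)) => /eqP.
have := weak_derivative_primitive ch kint wh cc2.
rewrite h0 cprim_twopi cintZ; last exact: eK_int.
rewrite /h -/c -/(Khat l) => E.
apply: (mulfI c0); rewrite mulr0 /Delta.
have -> : c * (1 - cexp (ii * l * (2 * pi)%:C) + ii * Khat l) =
  (c + ii * c * Khat l) - cexp (ii * l * (2 * pi)%:C) * c by ring.
by rewrite -E subrr.
Qed.

(** The eigenfunction is e^(-ilx) (1 + i \int_0^x e^(ilt) K(t) dt). Its value at 0 is 1, and
    Delta(l) = 0 says that its value at 2 pi is 1 as well. *)
Lemma Delta0_eigenvalue l : Delta l = 0 -> eigenvalues (P1 K) l.
Proof.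
move=> D0; pose u := ii * l.
pose g0 x := ii * (cexp (u * x%:C) * K x).
have ig0 : cintble g0 by apply: cintbleZ; exact: eK_int.
pose h x := 1 + cprim g0 x.
have ch : ccont h by apply: ccontD; [exact: ccont_cst|exact: cprim_ccont].
have wh : weak_derivative h g0.
  have := weak_derivativeD (ccont_cintble (ccont_cst 1)) (ccont_cintble (ccont_cst 0))
    (ccont_cintble (cprim_ccont ig0)) ig0 (weak_derivative_cst 1)
    (weak_derivative_cprim ig0).
  by under [X in weak_derivative _ X -> _]eq_fun do rewrite add0r.
pose f (x : R) : R[i] := cexp (- u * x%:C) * h x.
pose f' x := cexp (- u * x%:C) * (g0 x + - u * h x).
have wf : weak_derivative f f'.
  by apply: weak_derivative_cexpl => //; exact: ccont_cintble.
have cf : ccont f by apply: ccontM => //; exact: ccont_cexpl.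
have fL : L2 f := L2_ccont cf.
have f'L : L2 f'.
  apply: L2_contM; first exact: ccont_cexpl.
  apply: L2D; last by apply: L2Z; exact: L2_ccont.
  by apply: L2Z; apply: L2_contM => //; exact: ccont_cexpl.
have f_0 : f 0 = 1 by rewrite /f /h cprim_at0 mulr0 cexp0 addr0 mulr1.
have f_2 : f (2 * pi) = 1.
  rewrite /f /h cprim_twopi cintZ; last exact: eK_int.
  rewrite -/(Khat l).
  have -> : 1 + ii * Khat l = cexp (u * (2 * pi)%:C).
    by apply/eqP; rewrite -subr_eq0 -[X in _ == X]D0 /Delta -/u; apply/eqP; ring.
  by rewrite mulNr cexpNK.
exists f, (fun x => l * f x); split.
- split.
  + split; last by rewrite f_0 f_2.
    by split; [exact: cf.1|exact: cf.2|exact: fL|exists f'].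
  + exact: L2Z.
  + exists f'; split => //; apply: aeW => x _; rewrite f_2 mul1r /f' /g0 /f.
    have E : cexp (- u * x%:C) * cexp (u * x%:C) = 1 by rewrite mulNr cexpNK.
    have -> : ii * (cexp (- u * x%:C) * (ii * (cexp (u * x%:C) * K x) + - u * h x)) =
      (ii * ii) * (cexp (- u * x%:C) * cexp (u * x%:C)) * K x
      - (ii * ii) * l * (cexp (- u * x%:C) * h x) by rewrite /u; ring.
    by rewrite E mulII; ring.
- exact: aeW.
(* A continuous function that is zero almost everywhere is zero at 0 too, whereas f 0 = 1. *)
- move=> f0; have Rf0 : ae_eq mu Omega (fun x => Re (f x)) (fun=> 0).
    by apply: filterS f0 => x fx xO; have := fx xO; rewrite /f => ->.
  by have /eqP := ae0_rcont cf.1 Rf0 cc0; rewrite f_0 /= oner_eq0.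
Qed.

Lemma eigenvalueE l : eigenvalues (P1 K) l <-> Delta l = 0.
Proof. by split; [exact: eigenvalue_Delta0|exact: Delta0_eigenvalue]. Qed.

Lemma eigenvalue_spectrum (T : (R -> R[i]) -> (R -> R[i]) -> Prop) l :
  eigenvalues T l -> spectrum T l.
Proof. by move=> [f [g [Tfg gl f0]]] [inj _]; apply: f0; exact: inj Tfg gl. Qed.

End characteristic_function.

(** * Riemann-Lebesgue lemma *)

Section riemann_lebesgue.
Context {R : realType}.
Implicit Types (K H u : R -> R[i]) (l z : R[i]).

(** A finite upper bound for the L^1 norm of [K], used wherever [K] is integrated against a bounded
    function. *)
Definition mass K : R := Rint (Lmaj K).

Lemma mass_ge0 K : 0 <= mass K.
Proof. by apply: Rintegral_ge0 => x _; exact: Lmaj_ge0. Qed.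

Lemma cint_mass u K M : ccont u -> L2 K -> 0 <= M ->
  (forall x, Omega x -> normc (u x) <= M) ->
  normc (cintegral (fun x => u x * K x)) <= 2 * M * mass K.
Proof.
move=> cu KL M0 uM; rewrite -mulrA /mass -RintZ; last exact: L2_Lmaj.
apply: normc_cint.
- by apply: cintble_contM => //; exact: L2_cintble.
- by apply: rintZ; exact: L2_Lmaj.
- move=> x xO; rewrite Normc.normcM ler_pM ?normc_ge0 ?uM//.
  exact: normc_sqnormc.
Qed.

Lemma cint_FTC (F F' : R -> R[i]) : (forall x, is_cderive F x (F' x)) -> ccont F' ->
  cintegral F' = F (2 * pi) - F 0.
Proof.
move=> FF' [c1 c2]; rewrite cintE -!Rint_cc//.
rewrite (FTC_derivable (ltW twopi_gt0) (fun x => (FF' x).1))//.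
rewrite (FTC_derivable (ltW twopi_gt0) (fun x => (FF' x).2))//.
by apply: complexP; rewrite !ReImE.
Qed.

Lemma cint_cst (c : R[i]) : cintegral (fun=> c) = c * (2 * pi)%:C.
Proof.
rewrite (@cint_FTC (fun x => c * x%:C)).
- by rewrite mulr0 subr0.
- move=> x; apply: is_cderive_eq.
    exact: is_cderiveM (is_cderive_cst _ _) (is_cderive_id _).
  by rewrite mul0r add0r mulr1.
- exact: ccont_cst.
Qed.

Lemma cint_cexp_int (n : int) : n != 0 ->
  cintegral (fun t : R => cexp (ii * n%:~R * t%:C)) = 0.
Proof.
move=> n0; have a0 : ii * n%:~R != 0 :> R[i].
  by rewrite mulf_neq0 ?I_neq0 ?intr_eq0.
rewrite (@cint_FTC (fun t => (ii * n%:~R)^-1 * cexp (ii * n%:~R * t%:C))).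
- by rewrite cexp_2piI_int mulr0 cexp0 subrr.
- move=> x; apply: is_cderive_eq.
    exact: is_cderiveM (is_cderive_cst _ _) (is_cderive_cexpl _ _).
  by rewrite mul0r add0r mulKf.
- exact: ccont_cexpl.
Qed.

Definition energy H : R := Rint (fun x => sqnormc (H x)).

Lemma energy_ge0 H : 0 <= energy H.
Proof. by apply: Rintegral_ge0 => x _; exact: sqnormc_ge0. Qed.

(* H minus its orthogonal projection on the line spanned by e^(-int). *)
Definition deflate (n : int) H : R -> R[i] := fun x =>
  H x + - (Khat H n%:~R / (2 * pi)%:C) * cexp (- (ii * n%:~R) * x%:C).

Lemma deflate_L2 n H : L2 H -> L2 (deflate n H).
Proof.
move=> HL; apply: L2D => //; apply: L2Z; apply: L2_ccont; exact: ccont_cexpl.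
Qed.

(** By orthogonality of the exponentials, the removed component does not contribute to the other
    coefficients. *)
Lemma Khat_deflate (m n : int) H : L2 H -> m != n ->
  Khat (deflate n H) m%:~R = Khat H m%:~R.
Proof.
move=> HL mn; pose c := - (Khat H n%:~R / (2 * pi)%:C); rewrite /Khat.
transitivity (cintegral (fun t => cexp (ii * m%:~R * t%:C) * H t +
    c * cexp (ii * (m - n)%:~R * t%:C))).
  apply: eq_cint => t _; rewrite /deflate -/c mulrDr; congr (_ + _).
  rewrite mulrCA -cexpD; congr (_ * cexp _); rewrite rmorphB /=; ring.
rewrite cintD; last 2 first.
- exact: eK_int.
- by apply: cintbleZ; apply: ccont_cintble; exact: ccont_cexpl.
rewrite cintZ; last by apply: ccont_cintble; exact: ccont_cexpl.
by rewrite cint_cexp_int ?mulr0 ?addr0// subr_eq0.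
Qed.

(** Pythagoras. With F = e^(inx) H and [a] the integral of F, the deflated function has the modulus
    of F - a/(2 pi), because |e^(-inx)| = 1; the square is then expanded and integrated. *)
Lemma energy_deflate n H : L2 H ->
  energy (deflate n H) = energy H - normc (Khat H n%:~R) ^+ 2 / (2 * pi).
Proof.
move=> HL; have p0 : 2 * pi != 0 :> R by rewrite gt_eqF// twopi_gt0.
pose a := Khat H n%:~R.
pose F x := cexp (ii * n%:~R * x%:C) * H x.
have iF : cintble F by exact: eK_int.
have [iF1 iF2] := iF.
have iH : rint (fun x => sqnormc (H x)) by case: HL.
have Ia : Re a = Rint (fun x => Re (F x)) /\ Im a = Rint (fun x => Im (F x)) by [].
pose q : R := (2 * pi)^-1.
transitivity (Rint (fun x => sqnormc (H x) + (- (2 * q * Re a) * Re (F x) +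
    (- (2 * q * Im a) * Im (F x) + normc a ^+ 2 * q ^+ 2)))).
  apply: eq_Rint => x _; rewrite /deflate -/a.
  have -> : - (ii * n%:~R) * x%:C = - (ii * n%:~R * x%:C) :> R[i] by ring.
  set e := cexp (- _).
  have En : normc e ^+ 2 = 1.
    rewrite /e normc_cexp (_ : Re _ = 0) ?expR0 ?expr1n//.
    by rewrite intrc_real !ReImE; ring.
  have EF : H x = e * F x by rewrite /F mulrA cexpNK mul1r.
  have -> : H x + - (a / (2 * pi)%:C) * e = e * (F x - a * q%:C).
    by rewrite EF /q invc_real; ring.
  rewrite [in RHS]EF !sqnormcE !Normc.normcM !exprMn En !mul1r !sqr_normcE !ReImE.
  by ring.
have i1 : rint (fun x => - (2 * q * Re a) * Re (F x)) by exact: rintZ.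
have i2 : rint (fun x => - (2 * q * Im a) * Im (F x)) by exact: rintZ.
have i3 : rint (fun=> normc a ^+ 2 * q ^+ 2) by exact: rint_cst.
have i23 := rintD i2 i3; have i123 := rintD i1 i23.
rewrite (RintD iH i123) (RintD i1 i23) (RintD i2 i3) (RintZ _ iF1) (RintZ _ iF2).
rewrite -Ia.1 -Ia.2 -/(energy H).
have -> : Rint (fun=> normc a ^+ 2 * q ^+ 2) = normc a ^+ 2 * q ^+ 2 * (2 * pi).
  have /(congr1 (@complex.Re R)) := cint_cst (normc a ^+ 2 * q ^+ 2)%:C.
  by rewrite cintE !ReImE mulr0 subr0.
rewrite sqr_normcE -/q expr2 -(mulrA _ (q * q)) -(mulrA q) mulVf// mulr1; ring.
Qed.

(** Components are removed along s 0, s 1, and so on. Injectivity of [s] keeps the later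
    coefficients unchanged, and the energy stays nonnegative, so the squared coefficients are
    summable. *)
Lemma bessel_cvg0 K (s : nat -> int) : L2 K -> injective s ->
  forall e, 0 < e -> exists N, forall n, (N <= n)%N -> normc (Khat K (s n)%:~R) < e.
Proof.
move=> KL sI e e0.
pose H := fix H N := if N is N'.+1 then deflate (s N') (H N') else K.
have HL N : L2 (H N) by elim: N => //= N; exact: deflate_L2.
have Ha N m : (N <= m)%N -> Khat (H N) (s m)%:~R = Khat K (s m)%:~R.
  elim: N => //= N IH Nm; rewrite Khat_deflate ?IH// 1?ltnW//.
  by apply/eqP => /sI mN; rewrite mN ltnn in Nm.
pose a n := normc (Khat K (s n)%:~R) ^+ 2 / (2 * pi).
have HE N : energy (H N) = energy K - \sum_(0 <= n < N) a n.
  elim: N => [|N IH]; first by rewrite big_geq// subr0.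
  by rewrite big_nat_recr//= energy_deflate// IH Ha// opprD addrA.
have a0 n : 0 <= a n by rewrite divr_ge0 ?sqr_ge0// ltW// twopi_gt0.
have cv : cvgn (series a).
  apply: nondecreasing_is_cvgn.
    by apply/nondecreasing_seqP => n; rewrite !seriesEnat /= big_nat_recr//= lerDl.
  exists (energy K) => _ [n _ <-]; rewrite seriesEnat /=.
  by have := energy_ge0 (H n); rewrite HE subr_ge0.
have e20 : 0 < e ^+ 2 / (2 * pi) by rewrite divr_gt0 ?exprn_gt0// twopi_gt0.
have /cvgr0Pnorm_lt/(_ _ e20)[N _ NP] := cvg_series_cvg_0 cv.
exists N => n Nn; have := NP n Nn; rewrite ger0_norm// /a.
rewrite ltr_pM2r ?invr_gt0 ?twopi_gt0//.
by rewrite ltr_pXn2r// nnegrE ?normc_ge0// ltW.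
Qed.

Lemma riemann_lebesgue_int K : L2 K -> forall e, 0 < e ->
  exists N : nat, forall n : int, (N <= `|n|)%N -> normc (Khat K n%:~R) < e.
Proof.
move=> KL e e0.
have [|N1 P1] := @bessel_cvg0 K Posz KL _ e e0; first by move=> ? ? [].
have [|N2 P2] := @bessel_cvg0 K (fun n => - n%:Z) KL _ e e0.
  by move=> x y /oppr_inj[].
exists (maxn N1 N2) => n; rewrite geq_max => /andP[n1 n2].
by case: n n1 n2 => k n1 n2; [exact: P1|rewrite NegzE; exact: P2].
Qed.

Lemma ccont_texp m (w : R[i]) : ccont (fun t : R => texp m (w * t%:C)).
Proof.
elim: m => [|m IH].
  by under eq_fun do rewrite texp0; exact: ccont_cst.
under eq_fun do rewrite texpS; apply: ccontD => //; apply: ccontM; last exact: ccont_cst.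
by apply: ccontX; apply: ccontM; [exact: ccont_cst|exact: ccont_id].
Qed.

Lemma ccont_rexp m (w : R[i]) : ccont (fun t : R => rexp m (w * t%:C)).
Proof. by apply: ccontB; [exact: ccont_cexpl|exact: ccont_texp]. Qed.

Lemma rexp_le_mono m (w : R[i]) Y : normc w <= Y ->
  normc (rexp m w) <= (2 * Y) ^+ m * expR Y / m`!%:R.
Proof.
move=> wY; rewrite (le_trans (rexp_le _ _))// ler_wpM2r ?invr_ge0//.
have Y0 := le_trans (normc_ge0 w) wY.
rewrite ler_pM ?exprn_ge0 ?mulr_ge0 ?normc_ge0 ?expR_ge0 ?ler_expR//.
by rewrite lerXn2r ?nnegrE ?mulr_ge0 ?normc_ge0// ler_pM2l.
Qed.

Lemma normc_scale_Omega (w : R[i]) B t : normc w <= B -> Omega t ->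
  normc (ii * w * t%:C) <= B * (2 * pi).
Proof.
move=> wB; rewrite OmegaE => /andP[t0 t1].
rewrite !Normc.normcM normcI mul1r normc_real ger0_norm ?(ltW t0)//.
by rewrite ler_pM ?normc_ge0 ?(ltW t0)// ltW.
Qed.

Lemma normc_cexp_real (a t : R) : normc (cexp (ii * a%:C * t%:C)) = 1.
Proof.
by rewrite normc_cexp (_ : Re _ = 0) ?expR0// !ReImE; ring.
Qed.

(** The term of degree j equals (iz)^j / j! times the coefficient at n of t^j K, again a function in
    L^2. There are finitely many terms, so one N serves all z in the disc. *)
Lemma texp_Khat_small K B m : L2 K -> forall e, 0 < e ->
  exists N : nat, forall n : int, (N <= `|n|)%N -> forall z, normc z <= B ->
    normc (cintegral (fun t => cexp (ii * n%:~R * t%:C) *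
      (texp m (ii * z * t%:C) * K t))) < e.
Proof.
move=> KL; elim: m => [|m IH] e e0.
  exists 0%N => n _ z _; rewrite (eq_cint (g := fun=> 0)) => [|t _].
    by rewrite cint0 Normc.normc0.
  by rewrite texp0 mul0r mulr0.
have e2 : 0 < e / 2 by rewrite divr_gt0.
have [N1 P1] := IH _ e2.
have tL : L2 (fun t => t%:C ^+ m * K t) by apply: L2_contM => //; apply: ccontX; exact: ccont_id.
have B0 : 0 <= `|B| ^+ m by rewrite exprn_ge0.
(* [B] may be negative, hence the absolute value; adding 1 keeps the divisor positive. *)
have e3 : 0 < e / 2 / (`|B| ^+ m + 1) by rewrite divr_gt0// ltr_wpDl.
have [N2 P2] := riemann_lebesgue_int tL e3.
exists (maxn N1 N2) => n; rewrite geq_max => /andP[n1 n2] z zB.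
have ctexp j := ccont_texp j (ii * z).
pose c := (ii * z) ^+ m * (m`!%:R)^-1.
rewrite (eq_cint (g := fun t => cexp (ii * n%:~R * t%:C) * (texp m (ii * z * t%:C) * K t)
  + c * (cexp (ii * n%:~R * t%:C) * (t%:C ^+ m * K t)))) => [|t _]; last first.
  by rewrite texpS /c exprMn; ring.
have i1 : cintble (fun t => cexp (ii * n%:~R * t%:C) * (texp m (ii * z * t%:C) * K t)).
  by apply: cintble_contM; [exact: ccont_cexpl|apply: cintble_contM => //; exact: L2_cintble].
have i2 := eK_int tL n%:~R.
rewrite cintD//; last exact: cintbleZ.
rewrite cintZ// (le_lt_trans (normcD _ _))// (splitr e) ltr_leD ?P1//.
rewrite Normc.normcM.
apply: (@le_trans _ _ ((`|B| ^+ m + 1) * (e / 2 / (`|B| ^+ m + 1)))).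
  apply: ler_pM; rewrite ?normc_ge0//; last exact/ltW/P2.
  rewrite /c Normc.normcM Normc.normcV normcX Normc.normcM normcI mul1r.
  rewrite natrc_real normc_real ger0_norm//.
  have zBm : normc z ^+ m <= `|B| ^+ m.
    by rewrite lerXn2r ?nnegrE ?normc_ge0// (le_trans zB)// ler_norm.
  have f1 : (m`!%:R)^-1 <= 1 :> R by rewrite invf_le1 ?ler1n ?ltr0n fact_gt0.
  rewrite (@le_trans _ _ (normc z ^+ m * 1))// ?ler_wpM2l ?exprn_ge0 ?normc_ge0//.
  by rewrite mulr1 (le_trans zBm)// lerDl.
by rewrite mulrC divfK// gt_eqF// ltr_wpDl.
Qed.

(** The exponential e^(izt) is split into its Taylor polynomial and a remainder. The order m is
    fixed before N: the remainder is bounded independently of n, as |e^(int)| = 1. *)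
Lemma riemann_lebesgue_unif K B : L2 K -> forall e, 0 < e ->
  exists N : nat, forall n : int, (N <= `|n|)%N -> forall z, normc z <= B ->
    normc (Khat K (n%:~R + z)) < e.
Proof.
move=> KL e e0; have p0 := @twopi_gt0 R.
pose X : R := 2 * (`|B| * (2 * pi)); pose E := expR (`|B| * (2 * pi)).
have e2 : 0 < e / 2 / (2 * E * (mass K + 1)).
  by rewrite !divr_gt0// !mulr_gt0 ?expR_gt0// ltr_wpDl// mass_ge0.
have [m [m0 mX]] := expn_fact_cvg0 X e2.
have e2' : 0 < e / 2 by rewrite divr_gt0.
have [N P] := texp_Khat_small B m KL e2'.
exists N => n Nn z zB.
have cr := ccont_rexp m (ii * z).
rewrite (_ : Khat K _ = cintegral (fun t => cexp (ii * n%:~R * t%:C) *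
      (texp m (ii * z * t%:C) * K t)) +
    cintegral (fun t => rexp m (ii * z * t%:C) * cexp (ii * n%:~R * t%:C) * K t)); last first.
  rewrite -cintD; last 2 first.
  - apply: cintble_contM; first exact: ccont_cexpl.
    by apply: cintble_contM; [exact: ccont_texp|exact: L2_cintble].
  - apply: cintble_contM; last exact: L2_cintble.
    by apply: ccontM => //; exact: ccont_cexpl.
  apply: eq_cint => t _; rewrite mulrDr mulrDl cexpD /rexp; ring.
rewrite (le_lt_trans (normcD _ _))// (splitr e) ltr_leD ?P//.
apply: (@le_trans _ _ (2 * (X ^+ m * E / m`!%:R) * mass K)).
  apply: cint_mass => //.
  - by apply: ccontM => //; exact: ccont_cexpl.
  - rewrite divr_ge0// mulr_ge0 ?expR_ge0// exprn_ge0//.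
    by rewrite /X mulr_ge0// mulr_ge0// ltW.
  - move=> t tO; rewrite Normc.normcM intrc_real normc_cexp_real mulr1.
    apply: rexp_le_mono; apply: normc_scale_Omega => //.
    exact: le_trans zB (ler_norm _).
have E0 : 0 < E by exact: expR_gt0.
have M0 := mass_ge0 K.
have r0 : 0 <= X ^+ m / m`!%:R by rewrite divr_ge0// exprn_ge0// /X mulr_ge0// mulr_ge0// ltW.
move: mX; rewrite ler_pdivlMr ?mulr_gt0 ?ltr_wpDl// => mX.
apply: le_trans mX.
have -> : 2 * (X ^+ m * E / m`!%:R) * mass K = X ^+ m / m`!%:R * (2 * E * mass K) by ring.
by rewrite ler_wpM2l// ler_pM2l ?mulr_gt0// lerDl.
Qed.

End riemann_lebesgue.

(** * Location of the zeros *)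

Section contraction.
Context {R : realType}.
Implicit Types (z w : R[i]).

Lemma le_geometric0 (x C : R) : (forall k, x <= C / 2 ^+ k) -> x <= 0.
Proof.
move=> H; rewrite leNgt; apply/negP => x0.
have C0 : 0 < C by have := H 0%N; rewrite expr0 divr1; exact: lt_le_trans.
have Cx0 : 0 <= C / x by rewrite divr_ge0// ltW.
have := archi_boundP Cx0; set k := Num.bound _ => Ck.
have k2 : k%:R < 2 ^+ k :> R by rewrite -natrX ltr_nat ltn_expl.
have := H k; rewrite ler_pdivlMr ?exprn_gt0// => xk.
have : C < x * 2 ^+ k.
  by rewrite mulrC -ltr_pdivrMr// (lt_trans Ck k2).
by rewrite ltNge xk.
Qed.

(** With [d k] the sum of the tail C/2^j over j >= k, the intervals from u k - d k to u k + d k are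
    nested; the limit is the supremum of their left ends. *)
Lemma geometric_limit (u : nat -> R) C : (forall k, `|u k.+1 - u k| <= C / 2 ^+ k) ->
  exists l, forall k, `|l - u k| <= 2 * C / 2 ^+ k.
Proof.
move=> H; pose d k := 2 * C / 2 ^+ k.
have dS k : d k = d k.+1 + C / 2 ^+ k.
  by rewrite /d exprS; field; rewrite expf_neq0.
have C0 : 0 <= C by have := le_trans (normr_ge0 _) (H 0%N); rewrite expr0 divr1.
have d0 k : 0 <= d k by rewrite divr_ge0 ?mulr_ge0 ?exprn_ge0.
have vmono k j : u k - d k <= u (j + k)%N - d (j + k)%N.
  elim: j => // j IH; apply: le_trans IH _; rewrite addSn dS.
  by have := H (j + k)%N; rewrite ler_norml => /andP[]; lra.
have wmono k j : u (j + k)%N + d (j + k)%N <= u k + d k.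
  elim: j => // j IH; apply: le_trans _ IH; rewrite addSn (dS (j + k)%N).
  by have := H (j + k)%N; rewrite ler_norml => /andP[]; lra.
have vw j k : u j - d j <= u k + d k.
  have := vmono j k; have := wmono k j; rewrite addnC; have := d0 (k + j)%N; lra.
pose S := [set x | exists k, x = u k - d k].
have Sne : S (u 0%N - d 0%N) by exists 0%N.
exists (sup S) => k; rewrite ler_norml -/(d k); apply/andP; split.
  rewrite lerBrDr addrC; apply: ub_le_sup; last by exists k.
  by exists (u 0%N + d 0%N) => _ [j ->]; exact: vw.
rewrite lerBlDr addrC; apply: ge_sup; first by exists (u 0%N - d 0%N).
by move=> _ [j ->]; exact: vw.
Qed.

(** Iteration of T from 0. Real and imaginary parts converge separately, each with error 2 r / 2^k,
    which explains the 4 r below. *)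
Lemma disc_contraction (T : R[i] -> R[i]) (r : R) : 0 <= r ->
  (forall z, normc z <= r -> normc (T z) <= r) ->
  (forall z w, normc z <= r -> normc w <= r ->
    normc (T z - T w) <= 2^-1 * normc (z - w)) ->
  exists2 z, normc z <= r & T z = z.
Proof.
move=> r0 Tr TL; pose s k := iter k T 0.
have sr k : normc (s k) <= r.
  by elim: k => [|k IH]; rewrite ?Normc.normc0//=; exact: Tr.
have sd k : normc (s k.+1 - s k) <= r / 2 ^+ k.
  elim: k => [|k IH]; first by rewrite expr0 divr1 /= subr0; exact: (sr 1%N).
  rewrite (le_trans (TL _ _ (sr k.+1) (sr k)))// exprS invfM mulrCA ler_pM2l//.
have [|a aP] := @geometric_limit (fun k => Re (s k)) r.
  by move=> k; rewrite -ReN -ReD (le_trans (normRe_le _)).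
have [|b bP] := @geometric_limit (fun k => Im (s k)) r.
  by move=> k; rewrite -ImN -ImD (le_trans (normIm_le _)).
pose z := a +i* b.
have zs k : normc (z - s k) <= 4 * r / 2 ^+ k.
  have -> : 4 * r / 2 ^+ k = 2 * r / 2 ^+ k + 2 * r / 2 ^+ k by rewrite -mulrDl; ring.
  by rewrite (le_trans (normc_le _))// !ReImE lerD.
have zr : normc z <= r.
  rewrite -subr_le0; apply: (@le_geometric0 _ (4 * r)) => k.
  rewrite lerBlDr (le_trans _ (lerD (zs k) (sr k)))//.
  by rewrite -{1}(subrK (s k) z) normcD.
exists z => //; apply/eqP; rewrite -subr_eq0 -normc_eq0 eq_le normc_ge0 andbT.
apply: (@le_geometric0 _ (4 * r)) => k.
have -> : T z - z = (T z - T (s k)) - (z - s k.+1) by rewrite /=; ring.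
rewrite (le_trans (normcB _ _))//.
have := TL _ _ zr (sr k); have := zs k; have := zs k.+1; rewrite exprS invfM.
set X := (2 ^+ k)^-1; rewrite !mulrA; move: (normc (z - _)) (normc (T z - _)) => p q.
have : 4 * r * X = 4 * (r * X) by ring.
have -> : 4 * r / 2 * X = 2 * (r * X) by field.
have -> : 4 * r * X = 4 * (r * X) by ring.
by move=> *; lra.
Qed.

End contraction.

(** * Lipschitz bounds for the two perturbation terms *)

Section lipschitz.
Context {R : realType}.
Implicit Types (K : R -> R[i]) (l z w v : R[i]).

(** Without its constant term the polynomial only has terms (iv t)^j / j! with j >= 1. Each gives at
    most |v| |B|^(j-1) times the transform of t^j K at n + w, which is small by
    [riemann_lebesgue_unif]. *)
Lemma texp_Khat_lip K B m : L2 K -> forall e, 0 < e ->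
  exists N : nat, forall n : int, (N <= `|n|)%N -> forall w v,
    normc w <= B -> normc v <= B ->
    normc (cintegral (fun t => cexp (ii * (n%:~R + w) * t%:C) *
      ((texp m.+1 (ii * v * t%:C) - 1) * K t))) <= e * normc v.
Proof.
move=> KL; elim: m => [|m IH] e e0.
  exists 0%N => n _ w v _ _; rewrite (eq_cint (g := fun=> 0)) => [|t _].
    by rewrite cint0 Normc.normc0 mulr_ge0 ?normc_ge0// ltW.
  by rewrite texpS texp0 expr0 fact0 invr1 mulr1 add0r subrr mul0r mulr0.
have e2 : 0 < e / 2 by rewrite divr_gt0.
have [N1 P1] := IH _ e2.
have tL : L2 (fun t => t%:C ^+ m.+1 * K t).
  by apply: L2_contM => //; apply: ccontX; exact: ccont_id.
have B0 : 0 <= `|B| ^+ m by rewrite exprn_ge0.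
have e3 : 0 < e / 2 / (`|B| ^+ m + 1) by rewrite divr_gt0// ltr_wpDl.
have [N2 P2] := riemann_lebesgue_unif B tL e3.
exists (maxn N1 N2) => n; rewrite geq_max => /andP[n1 n2] w v wB vB.
have ctexp j := ccont_texp j (ii * v).
have cex := ccont_cexpl (ii * (n%:~R + w)).
pose c := (ii * v) ^+ m.+1 * (m.+1`!%:R)^-1.
rewrite (eq_cint (g := fun t => cexp (ii * (n%:~R + w) * t%:C) *
    ((texp m.+1 (ii * v * t%:C) - 1) * K t)
  + c * (cexp (ii * (n%:~R + w) * t%:C) * (t%:C ^+ m.+1 * K t)))) => [|t _]; last first.
  by rewrite (texpS m.+1) /c exprMn; ring.
have i1 : cintble (fun t => cexp (ii * (n%:~R + w) * t%:C) *
    ((texp m.+1 (ii * v * t%:C) - 1) * K t)).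
  apply: cintble_contM => //; apply: cintble_contM; last exact: L2_cintble.
  by apply: ccontB => //; exact: ccont_cst.
have i2 := eK_int tL (n%:~R + w).
rewrite cintD//; last exact: cintbleZ.
rewrite cintZ// (le_trans (normcD _ _))// (splitr e) mulrDl lerD ?P1//.
rewrite Normc.normcM.
have cB : normc c <= normc v * (`|B| ^+ m + 1).
  rewrite /c Normc.normcM Normc.normcV normcX Normc.normcM normcI mul1r.
  rewrite natrc_real normc_real ger0_norm// exprS -mulrA ler_wpM2l ?normc_ge0//.
  have vBm : normc v ^+ m <= `|B| ^+ m.
    by rewrite lerXn2r ?nnegrE ?normc_ge0// (le_trans vB)// ler_norm.
  have f1 : (m.+1`!%:R)^-1 <= 1 :> R by rewrite invf_le1 ?ler1n ?ltr0n fact_gt0.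
  rewrite (@le_trans _ _ (normc v ^+ m * 1))// ?ler_wpM2l ?exprn_ge0 ?normc_ge0//.
  by rewrite mulr1 (le_trans vBm)// lerDl.
apply: (@le_trans _ _ (normc v * (`|B| ^+ m + 1) * (e / 2 / (`|B| ^+ m + 1)))).
  by apply: ler_pM; rewrite ?normc_ge0//; exact/ltW/P2.
have S0 : `|B| ^+ m + 1 != 0 by rewrite gt_eqF// ltr_wpDl.
by rewrite le_eqVlt; apply/orP; left; apply/eqP; field.
Qed.

(** With v = z - w, the difference of the two exponentials is e^(i(n+w)t) (e^(ivt) - 1). In the
    remainder of order m+1 one factor |v| is set aside for the Lipschitz bound, and the other m make
    it small. *)
Lemma Khat_lip K B : L2 K -> forall e, 0 < e ->
  exists N : nat, forall n : int, (N <= `|n|)%N -> forall z w,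
    normc z <= B -> normc w <= B ->
    normc (Khat K (n%:~R + z) - Khat K (n%:~R + w)) <= e * normc (z - w).
Proof.
move=> KL e e0; have p0 := @twopi_gt0 R; have M0 := mass_ge0 K.
pose B2 : R := 2 * `|B|; have B20 : 0 <= B2 by rewrite mulr_ge0.
(* The three factors bound |e^(iwt)|, the constant that accompanies the factor |v| set aside, and
   the exponential in the remainder estimate; [B2] bounds |z - w|. *)
pose D : R := expR (`|B| * (2 * pi)) * (2 * (2 * pi)) * expR (B2 * (2 * pi)).
have D0 : 0 < D by rewrite !mulr_gt0 ?expR_gt0 ?pi_gt0.
pose X : R := 2 * (B2 * (2 * pi)).
have X0 : 0 <= X by rewrite /X mulr_ge0// mulr_ge0// ltW.
have M1 : 0 < mass K + 1 by rewrite ltr_wpDl.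
have DM : 0 < 2 * D * (mass K + 1) by rewrite mulr_gt0// mulr_gt0.
have e2 : 0 < e / 2 / (2 * D * (mass K + 1)) by rewrite !divr_gt0.
have [m [m0 mX]] := expn_fact_cvg0 X e2.
have r0 : 0 <= X ^+ m / m`!%:R by rewrite divr_ge0// exprn_ge0.
have e2' : 0 < e / 2 by rewrite divr_gt0.
have [N P] := texp_Khat_lip B2 m KL e2'.
exists N => n Nn z w zB wB; pose v := z - w.
have zB' : normc z <= `|B| by rewrite (le_trans zB) ?ler_norm.
have wB' : normc w <= `|B| by rewrite (le_trans wB) ?ler_norm.
have vB : normc v <= B2.
  by rewrite (le_trans (normcB _ _))// /B2 mulr_natl mulr2n lerD.
have cr := ccont_rexp m.+1 (ii * v).
have cex := ccont_cexpl (ii * (n%:~R + w)).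
have Ki := L2_cintble KL.
rewrite (_ : Khat K _ - _ = cintegral (fun t => cexp (ii * (n%:~R + w) * t%:C) *
      ((texp m.+1 (ii * v * t%:C) - 1) * K t)) +
    cintegral (fun t => cexp (ii * (n%:~R + w) * t%:C) *
      rexp m.+1 (ii * v * t%:C) * K t)); last first.
  rewrite -cintB; try exact: eK_int.
  rewrite -cintD; last 2 first.
  - apply: cintble_contM => //; apply: cintble_contM => //.
    by apply: ccontB; [exact: ccont_texp|exact: ccont_cst].
  - by apply: cintble_contM => //; exact: ccontM.
  apply: eq_cint => t _; rewrite /rexp.
  have -> : ii * (n%:~R + z) * t%:C = ii * (n%:~R + w) * t%:C + ii * v * t%:C :> R[i].
    by rewrite /v; ring.
  by rewrite cexpD; ring.
rewrite (le_trans (normcD _ _))// (splitr e) mulrDl lerD//.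
  by apply: P => //; apply: le_trans wB' _; rewrite /B2 ler_peMl// ler1n.
apply: (@le_trans _ _ (2 * (normc v * D * (X ^+ m / m`!%:R)) * mass K)).
  apply: cint_mass => //.
  - exact: ccontM.
  - by apply: mulr_ge0 => //; apply: mulr_ge0; [exact: normc_ge0|exact: ltW].
  - move=> t tO; rewrite Normc.normcM mulrDr mulrDl cexpD Normc.normcM.
    rewrite intrc_real normc_cexp_real mul1r.
    have c1 : normc (cexp (ii * w * t%:C)) <= expR (`|B| * (2 * pi)).
      rewrite normc_cexp ler_expR (le_trans (ler_norm _))//.
      by rewrite (le_trans (normRe_le _))// normc_scale_Omega.
    have c2 := rexp_le_mono m.+1 (normc_scale_Omega (lexx (normc v)) tO).
    apply: (le_trans (ler_pM (normc_ge0 _) (normc_ge0 _) c1 c2)).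
    rewrite /D exprS factS natrM invfM.
    have E1 : expR (normc v * (2 * pi)) <= expR (B2 * (2 * pi)).
      by rewrite ler_expR ler_pM2r.
    have E2 : (2 * (normc v * (2 * pi))) ^+ m <= X ^+ m.
      apply: lerXn2r; rewrite ?nnegrE//; first by rewrite !mulr_ge0 ?normc_ge0 ?pi_ge0.
      by rewrite /X ler_pM2l// ler_pM2r.
    have E3 : m.+1%:R^-1 <= 1 :> R by rewrite invf_le1 ?ler1n ?ltr0n.
    set p := expR (`|B| * _); set q := m`!%:R^-1.
    have q0 : 0 <= q by rewrite invr_ge0.
    have pp : 0 <= p by exact: expR_ge0.
    have -> : p * (2 * (normc v * (2 * pi)) * (2 * (normc v * (2 * pi))) ^+ m *
        expR (normc v * (2 * pi)) * (m.+1%:R^-1 * q)) =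
      (normc v * p * (2 * (2 * pi)) * q) * ((2 * (normc v * (2 * pi))) ^+ m *
        expR (normc v * (2 * pi)) * m.+1%:R^-1) by ring.
    have -> : normc v * (p * (2 * (2 * pi)) * expR (B2 * (2 * pi))) * (X ^+ m * q) =
      (normc v * p * (2 * (2 * pi)) * q) * (X ^+ m * expR (B2 * (2 * pi)) * 1) by ring.
    apply: ler_wpM2l.
      by rewrite !mulr_ge0 ?normc_ge0 ?pi_ge0.
    apply: ler_pM => //.
      by rewrite !mulr_ge0 ?exprn_ge0 ?expR_ge0 ?mulr_ge0 ?normc_ge0 ?pi_ge0.
    apply: ler_pM => //; rewrite ?expR_ge0//.
    by rewrite exprn_ge0 ?mulr_ge0 ?normc_ge0 ?pi_ge0.
move: mX; rewrite ler_pdivlMr// => mX.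
have -> : 2 * (normc v * D * (X ^+ m / m`!%:R)) * mass K =
  (X ^+ m / m`!%:R * (2 * D * mass K)) * normc v by ring.
rewrite ler_wpM2r ?normc_ge0//; apply: le_trans mX.
apply: ler_wpM2l => //; apply: ler_wpM2l; last by rewrite lerDl.
by rewrite mulr_ge0// ltW.
Qed.

(** The nonlinear part of e^(2 pi i z) at 0, so that Delta(n + z) = - 2 pi i z - rho z + i Khat(n +
    z). *)
Definition rho z := rexp 2 (ii * z * (2 * pi)%:C).

Lemma rhoE z : rho z = cexp (ii * z * (2 * pi)%:C) - 1 - ii * z * (2 * pi)%:C.
Proof.
rewrite /rho /rexp !texpS texp0 add0r expr0 expr1 fact0 (factS 0) mul1n fact0 invr1.
by rewrite !mulr1 opprD addrA.
Qed.

(** The constant is of order r because the derivative of rho vanishes at 0. Concretely, with v = z -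
    w, rho z - rho w = e^(2 pi i w) rho v + (e^(2 pi i w) - 1) 2 pi i v, and the two terms are of
    order |v|^2 and r |v|. *)
Lemma rho_lip : exists2 C : R, 0 < C & forall r, 0 <= r -> r <= 1 ->
  forall z w, normc z <= r -> normc w <= r ->
    normc (rho z - rho w) <= C * r * normc (z - w).
Proof.
have p0 := @twopi_gt0 R; pose P : R := 2 * pi; pose E := expR (2 * P).
have E0 : 0 < E by exact: expR_gt0.
have P0 : 0 < P by [].
exists (4 * P ^+ 2 * E * E + 2 * P ^+ 2 * E) => [|r r0 r1 z w zr wr].
  have PP : 0 < P ^+ 2 by exact: exprn_gt0.
  by apply: addr_gt0; do 3?[apply: mulr_gt0 => //].
pose v := z - w.
have vr : normc v <= 2 * r by rewrite (le_trans (normcB _ _))// mulr_natl mulr2n lerD.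
have sc (y : R[i]) : normc (ii * y * (2 * pi)%:C) = normc y * P.
  by rewrite !Normc.normcM normcI mul1r normc_real ger0_norm// ltW.
have -> : rho z - rho w = cexp (ii * w * (2 * pi)%:C) * rexp 2 (ii * v * (2 * pi)%:C)
   + rexp 1 (ii * w * (2 * pi)%:C) * (ii * v * (2 * pi)%:C).
  rewrite -/(rho v) !rhoE /rexp texpS texp0 add0r expr0 fact0 invr1 mulr1.
  have -> : ii * z * (2 * pi)%:C = ii * w * (2 * pi)%:C + ii * v * (2 * pi)%:C :> R[i].
    by rewrite /v; ring.
  by rewrite cexpD; ring.
have v0 := normc_ge0 v.
have eE x : x <= 2 * r -> expR (x * P) <= E.
  by move=> x2; rewrite ler_expR ler_pM2r// (le_trans x2)// ler_piMr.
have c1 : normc (cexp (ii * w * (2 * pi)%:C)) <= E.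
  rewrite normc_cexp (le_trans _ (eE (normc w) _))//.
    rewrite ler_expR (le_trans (ler_norm _))//.
    by rewrite (le_trans (normRe_le _))// sc.
  by rewrite (le_trans wr)// ler_peMl// ler1n.
have c2 : normc (rexp 2 (ii * v * (2 * pi)%:C)) <= 4 * P ^+ 2 * E * r * normc v.
  rewrite (le_trans (rexp_le _ _))// sc.
  have -> : (2 * (normc v * P)) ^+ 2 * expR (normc v * P) / 2`!%:R =
    (2 * P ^+ 2 * normc v) * (normc v * expR (normc v * P)).
    by rewrite !factS fact0; field.
  have -> : 4 * P ^+ 2 * E * r * normc v = (2 * P ^+ 2 * normc v) * (2 * r * E) by ring.
  apply: ler_wpM2l.
    by rewrite mulr_ge0// mulr_ge0// exprn_ge0// ltW.
  by apply: ler_pM => //; exact: eE.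
have c3 : normc (rexp 1 (ii * w * (2 * pi)%:C)) <= 2 * P * E * r.
  rewrite (le_trans (rexp_le _ _))// sc (factS 0) mul1n fact0 divr1 expr1.
  have -> : 2 * (normc w * P) * expR (normc w * P) = 2 * P * (normc w * expR (normc w * P)).
    by ring.
  have -> : 2 * P * E * r = 2 * P * (r * E) by ring.
  apply: ler_wpM2l; first by rewrite mulr_ge0// ltW.
  apply: ler_pM => //; first exact: normc_ge0.
  by apply: eE; rewrite (le_trans wr)// ler_peMl// ler1n.
rewrite (le_trans (normcD _ _))// -/v.
have -> : (4 * P ^+ 2 * E * E + 2 * P ^+ 2 * E) * r * normc v =
  E * (4 * P ^+ 2 * E * r * normc v) + (2 * P * E * r) * (normc v * P) by ring.
apply: lerD; rewrite [leLHS]Normc.normcM.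
  by apply: ler_pM; rewrite ?normc_ge0.
by rewrite sc; apply: ler_wpM2r => //; rewrite mulr_ge0// ltW.
Qed.

End lipschitz.

(** * Zeros close to large integers *)

Section zeros_near_integers.
Context {R : realType}.
Implicit Types (K : R -> R[i]) (l z w v : R[i]).

Lemma Delta_shift K (n : int) z :
  Delta K (n%:~R + z) = 1 - cexp (ii * z * (2 * pi)%:C) + ii * Khat K (n%:~R + z).
Proof.
rewrite /Delta; have -> : ii * (n%:~R + z) * (2 * pi)%:C =
  ii * n%:~R * (2 * pi)%:C + ii * z * (2 * pi)%:C :> R[i] by ring.
by rewrite cexpD cexp_2piI_int mul1r.
Qed.

Lemma unique_zero_near_int K : L2 K -> exists2 d0 : R, 0 < d0 &
  forall d, 0 < d -> d <= d0 -> exists N : nat, forall n : int, (N <= `|n|)%N ->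
  exists z, [/\ normc z <= d, Delta K (n%:~R + z) = 0 &
    forall w, normc w <= d -> Delta K (n%:~R + w) = 0 -> w = z].
Proof.
move=> KL; have [C C0 rhoC] := @rho_lip R.
(* With d <= 1 and C d <= 1, the Lipschitz constant of T below is at most (1 + C d)/(2 pi) <=
   2/4. *)
exists (Num.min 1 C^-1) => [|d d0]; first by rewrite lt_min ltr01 invr_gt0.
rewrite le_min => /andP[d1 dC].
have Cd : C * d <= 1 by rewrite mulrC -ler_pdivlMr// div1r.
have [N1 P1] := Khat_lip 1 KL (ltr01 : 0 < 1 :> R).
(* Radius 0 suffices: this only bounds T 0 by d/2, and the contraction then keeps the disc of radius
   d stable. *)
have [N2 P2] := riemann_lebesgue_unif 0 KL d0.
exists (maxn N1 N2) => n; rewrite geq_max => /andP[n1 n2].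
pose a : R[i] := ii * (2 * pi)%:C.
have na : normc a = 2 * pi.
  by rewrite /a Normc.normcM normcI mul1r normc_real ger0_norm// ltW// twopi_gt0.
have a0 : a != 0 by rewrite -normc_eq0 na gt_eqF// twopi_gt0.
(* By [TE] below, the zeros of z |-> Delta (n + z) are the fixed points of T. *)
pose T z := (ii * Khat K (n%:~R + z) - rho z) / a.
have TE z : Delta K (n%:~R + z) = (T z - z) * a.
  by rewrite Delta_shift mulrBl /T divfK// rhoE /a; ring.
have pi2 : 4 <= 2 * pi :> R by have := pi_ge2 R; lra.
have TL z w : normc z <= d -> normc w <= d ->
    normc (T z - T w) <= 2^-1 * normc (z - w).
  move=> zd wd; rewrite /T -mulrBl Normc.normcM Normc.normcV na.
  rewrite ler_pdivrMr ?twopi_gt0//.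
  have -> : ii * Khat K (n%:~R + z) - rho z - (ii * Khat K (n%:~R + w) - rho w) =
    ii * (Khat K (n%:~R + z) - Khat K (n%:~R + w)) - (rho z - rho w) by ring.
  rewrite (le_trans (normcB _ _))// Normc.normcM normcI mul1r.
  have := P1 n n1 z w (le_trans zd d1) (le_trans wd d1).
  have := rhoC d (ltW d0) d1 z w zd wd.
  have := normc_ge0 (z - w); move: (normc (z - w)) => x x0.
  by move: (normc _) (normc _) => p q; nra.
have Tr z : normc z <= d -> normc (T z) <= d.
  move=> zd; have T0 : normc (T 0) <= d / 2.
    rewrite /T (_ : rho 0 = 0); last by rewrite rhoE mulr0 mul0r cexp0 !subrr.
    rewrite subr0 !Normc.normcM normcI mul1r Normc.normcV na.
    rewrite ler_pdivrMr ?twopi_gt0//.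
    have := P2 n n2 0; rewrite Normc.normc0 lexx => /(_ isT).
    by move: (normc _) => p; nra.
  have := TL z 0 zd; rewrite Normc.normc0 subr0 => /(_ (ltW d0)) Tz.
  rewrite -(subrK (T 0) (T z)) (le_trans (normcD _ _))//.
  by move: Tz T0 zd; move: (normc _) (normc _) (normc _) => *; lra.
have [z zd Tz] := disc_contraction (ltW d0) Tr TL.
exists z; split=> //; first by rewrite TE Tz subrr mul0r.
move=> w wd; rewrite TE => /eqP; rewrite mulf_eq0 (negbTE a0) orbF subr_eq0 => /eqP Tw.
have := TL w z wd zd; rewrite Tw Tz => wz.
apply/eqP; rewrite -subr_eq0 -normc_eq0 eq_le normc_ge0 andbT.
by move: wz; move: (normc _) => *; lra.
Qed.

(** The modulus of e^(2 pi i z) is e^(-2 pi Im z); its closeness to 1 forces |Im z| < d. The real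
    part then forces cos(2 pi Re z) above cos(2 pi d), and cosine is decreasing on [0, pi], where
    |Re z| <= 1/2 places the argument. *)
Lemma near_integer (d : R) : 0 < d -> d <= 2^-1 -> exists2 e : R, 0 < e &
  forall z, `|Re z| <= 2^-1 -> normc (1 - cexp (ii * z * (2 * pi)%:C)) < e ->
  normc z < 2 * d.
Proof.
move=> d0 d2; have p0 := @twopi_gt0 R; have ppi := @pi_gt0 R.
pose k : R := cos (2 * pi * d); pose g : R := expR (- (2 * pi * d)).
have g1 : g < 1 by rewrite expR_lt1 oppr_lt0 mulr_gt0.
have g0 : 0 < g by exact: expR_gt0.
have cc (x : R) : 0 <= x -> x <= 2^-1 -> 2 * pi * x \in `[0, pi : R].
  move=> x0 x2; rewrite in_itv/= mulr_ge0 ?(ltW p0)//=.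
  have : pi * x <= pi * 2^-1 by rewrite ler_pM2l.
  lra.
have k1 : k < 1.
  rewrite /k -[X in _ < X]cos0 ltr_cos ?cc ?(ltW d0)//; first exact: mulr_gt0.
  by rewrite in_itv/= lexx ltW.
(* The first bound also covers negative imaginary parts, since 1/g - 1 >= 1 - g. For the second, |Re
   z| >= d and k >= 0 would give 1 - k <= (1 + k) n1 < 2 n1, with [n1] the norm below. *)
exists (Num.min (1 - g) ((1 - k) / 2)) => [|z xz].
  by rewrite lt_min !subr_gt0 g1 divr_gt0 ?subr_gt0.
rewrite lt_min; set n1 := normc _ => /andP[ng nk].
pose x := Re z; pose y := Im z.
pose r : R := expR (- (2 * pi * y)).
have r0 : 0 < r by exact: expR_gt0.
have eE : cexp (ii * z * (2 * pi)%:C) = (r * cos (2 * pi * x)) +i* (r * sin (2 * pi * x)).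
  rewrite /cexp /r; congr ((expR _ * cos _) +i* (expR _ * sin _));
  rewrite !ReImE /x /y; ring.
have nr : `|r - 1| <= n1.
  have -> : r = normc (cexp (ii * z * (2 * pi)%:C)).
    rewrite normc_cexp /r; congr expR; rewrite !ReImE /y; ring.
  rewrite /n1; set e := cexp _.
  have := normcD (1 - e) e; have := normcD (e - 1) 1.
  rewrite !subrK Normc.normc1 (normc_dist e 1) => A B.
  by rewrite ler_norml lerNl opprB !lerBlDr A B.
have nc : 1 - r * cos (2 * pi * x) <= n1.
  rewrite (le_trans (ler_norm _))// (le_trans _ (normRe_le _))// /n1 eE.
  by rewrite !ReImE.
have yd : `|y| < d.
  rewrite ltNge; apply/negP => dy; move: nr; rewrite ler_norml => /andP[r1 r2].
  have [y0|y0] := leP 0 y.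
    rewrite ger0_norm// in dy.
    have : r <= g by rewrite ler_expR lerN2 ler_pM2l.
    lra.
  rewrite ltr0_norm// in dy.
  have : g^-1 <= r by rewrite /g -expRN ler_expR opprK -mulrN ler_pM2l.
  have : 1 + (1 - g) <= g^-1.
    by rewrite -div1r ler_pdivlMr//; nra.
  lra.
have xd : `|x| < d.
  rewrite ltNge; apply/negP => dx.
  have : cos (2 * pi * x) <= k.
    have -> : cos (2 * pi * x) = cos (2 * pi * `|x|).
      by have [x0|x0] := leP 0 x; [rewrite ger0_norm|rewrite ltr0_norm// mulrN cosN].
    by rewrite /k leNgt ltr_cos -?leNgt ?ler_pM2l// cc// ltW.
  move: nr; rewrite ler_norml => /andP[r1 r2] ck.
  have : r * cos (2 * pi * x) <= r * k by rewrite ler_pM2l.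
  have [k0|k0] := leP 0 k; nra.
by rewrite (le_lt_trans (normc_le _))// mulr_natl mulr2n ltrD.
Qed.

End zeros_near_integers.

(** * Zeros lie in a horizontal strip *)

Section zeros_in_strip.
Context {R : realType}.
Implicit Types (K u : R -> R[i]) (l z : R[i]) (a b : R).

(** A weighted form of Cauchy-Schwarz: |u K| <= s w + |K|^2 / s when |u| <= w <= 1. A large s makes
    the energy term small; a Y much larger than s then handles the other one. *)
Lemma cint_weight (w : R -> R) u K (Y s : R) : L2 K -> ccont u -> rcont w -> 0 < s ->
  (forall x, Omega x -> normc (u x) <= w x) -> (forall x, Omega x -> w x <= 1) ->
  Rint w <= Y^-1 ->
  normc (cintegral (fun x => u x * K x)) <= 2 * (s * Y^-1 + s^-1 * energy K).
Proof.
move=> KL cu cw s0 uw w1 wY.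
have iK : rint (fun x => sqnormc (K x)) by case: KL.
have iw := rcont_rint cw.
have i1 := rintZ s iw; have i2 := rintZ s^-1 iK.
apply: (@le_trans _ _ (2 * Rint (fun x => s * w x + s^-1 * sqnormc (K x)))).
  apply: normc_cint; [|exact: rintD|].
    by apply: cintble_contM => //; exact: L2_cintble.
  move=> x xO; rewrite Normc.normcM sqnormcE.
  have := normc_ge0 (K x); move: (normc (K x)) => k k0.
  have w0 : 0 <= w x := le_trans (normc_ge0 _) (uw x xO).
  apply: (@le_trans _ _ (w x * k)); first by rewrite ler_wpM2r// uw.
  (* k <= s + k^2 / s *)
  have [ks|sk] := leP k s.
    have : 0 <= s^-1 * k ^+ 2 by rewrite mulr_ge0 ?sqr_ge0// invr_ge0 ltW.
    have := ler_wpM2l w0 ks; lra.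
  have : k <= s^-1 * k ^+ 2 by rewrite mulrC ler_pdivlMr// expr2 ler_wpM2l// ltW.
  have := ler_wpM2r k0 (w1 x xO); have := mulr_ge0 (ltW s0) w0; lra.
by rewrite (RintD i1 i2) !RintZ// ler_pM2l// lerD2r ler_pM2l.
Qed.

Lemma is_derive_expR_affine a b (x : R) :
  is_derive x 1 (fun t => expR (a * t + b)) (a * expR (a * x + b)).
Proof.
have D : is_derive x 1 (fun t => a * t + b) a.
  have := is_deriveD (is_derive_mul (is_derive_cst a x 1) (is_derive_id x 1))
    (is_derive_cst b x 1).
  by move/is_derive_eq; apply; rewrite mul0r add0r mulr1 addr0.
exact: is_derive_comp_fun D (is_derive_expR _).
Qed.

Lemma Rint_expR_affine a b : a != 0 ->
  Rint (fun t => expR (a * t + b)) = (expR (a * (2 * pi) + b) - expR b) / a.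
Proof.
move=> a0; have c1 : rcont (fun t => expR (a * t + b)).
  exact: (rcont_is_derive (is_derive_expR_affine a b)).
have D (x : R) : is_derive x 1 (fun t => a^-1 * expR (a * t + b)) (expR (a * x + b)).
  have := is_derive_mul (is_derive_cst a^-1 x 1) (is_derive_expR_affine a b x).
  by move/is_derive_eq; apply; rewrite mul0r add0r mulKf.
rewrite -Rint_cc// (FTC_derivable (ltW twopi_gt0) D c1) mulr0 add0r.
by rewrite -mulrBr mulrC.
Qed.

Lemma expRN_small (x : R) : 3 <= x -> expR (- x) <= 4^-1.
Proof.
move=> x3; rewrite expRN lef_pV2 ?posrE ?expR_gt0//.
have := expR_ge1Dx x; lra.
Qed.

Lemma zeros_Im_bounded K : L2 K -> exists2 M : R, 0 < M &
  forall l, Delta K l = 0 -> `|Im l| <= M.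
Proof.
(* This s gives energy/s <= 1/16, and Y > 16 s gives s/Y <= 1/16, whence the bound 1/4 on the
   integral term. The exponential is at most 1/4 too, and the two cannot add up to 1. *)
move=> KL; have S0 := energy_ge0 K; pose s := 16 * (energy K + 1).
have s16 : 16 <= s by rewrite /s; lra.
have s0 : 0 < s by lra.
exists (16 * s) => [|l Dl]; first by rewrite mulr_gt0.
rewrite leNgt; apply/negP; set Y := `|_| => YM.
have Y0 : 0 < Y by lra.
have pi4 : 4 <= 2 * pi :> R by have := pi_ge2 R; lra.
have EY : expR (- (2 * pi * Y)) <= 4^-1 by apply: expRN_small; nra.
have B : 2 * (s * Y^-1 + s^-1 * energy K) <= 4^-1.
  have : s * Y^-1 <= 16^-1 by rewrite ler_pdivrMr//; lra.
  have : s^-1 * energy K <= 16^-1 by rewrite mulrC ler_pdivrMr// /s; lra.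
  lra.
pose y := Im l.
have nE t : normc (cexp (ii * l * t%:C)) = expR (- y * t + 0).
  by rewrite normc_cexp; congr expR; rewrite !ReImE /y; ring.
have expN1 (x : R) : x <= 0 -> expR x <= 1 by move=> x0; rewrite -(expR0 R) ler_expR.
have [y0|y0] := leP 0 y.
  have Yy : Y = y by rewrite /Y ger0_norm.
  have yn0 : - y != 0 by rewrite oppr_eq0 -Yy gt_eqF.
  have : normc (Khat K l) <= 4^-1.
    apply: le_trans B; apply: (cint_weight (w := fun t => expR (- y * t + 0))) => //.
    - exact: ccont_cexpl.
    - exact: (rcont_is_derive (is_derive_expR_affine (- y) 0)).
    - by move=> t _; rewrite nE.
    - move=> t; rewrite OmegaE => /andP[t0 _]; apply: expN1.
      by rewrite addr0 mulNr oppr_le0 mulr_ge0// ltW.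
    - rewrite Rint_expR_affine// invrN mulrN -mulNr opprB Yy ler_piMl ?invr_ge0//.
  move: Dl; rewrite /Delta => /eqP; rewrite addrAC subr_eq0 => /eqP E.
  have := normcB (cexp (ii * l * (2 * pi)%:C)) (ii * Khat K l).
  rewrite -E addrK Normc.normc1 E nE Normc.normcM normcI mul1r addr0.
  have -> : - y * (2 * pi) = - (2 * pi * Y) by rewrite Yy; ring.
  move=> H1 H2; have := le_trans H1 (lerD EY H2); clear; lra.
have Yy : Y = - y by rewrite /Y ltr0_norm.
(* In the lower half plane e^(ilt) is largest at t = 2 pi; multiplication by [F] makes its modulus
   the weight e^(Y(t - 2 pi)) <= 1. *)
pose F := cexp (- (ii * l * (2 * pi)%:C)).
have nF t : normc (F * cexp (ii * l * t%:C)) = expR (Y * t + - (2 * pi * Y)).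
  rewrite Normc.normcM nE normc_cexp -expRD; congr expR.
  by rewrite Yy !ReImE -/y; ring.
have : normc (F * Khat K l) <= 4^-1.
  rewrite /Khat -cintZ; last exact: eK_int.
  rewrite (eq_cint (g := fun t => F * cexp (ii * l * t%:C) * K t)) => [|t _]; last first.
    by rewrite mulrA.
  apply: le_trans B.
  apply: (cint_weight (w := fun t => expR (Y * t + - (2 * pi * Y)))) => //.
  - by apply: ccontM; [exact: ccont_cst|exact: ccont_cexpl].
  - exact: (rcont_is_derive (is_derive_expR_affine _ _)).
  - by move=> t _; rewrite nF.
  - move=> t; rewrite OmegaE => /andP[_ t1]; apply: expN1.
    by rewrite [Y * t]mulrC -mulrBl mulr_le0_ge0 ?subr_le0 ?ltW.
  - rewrite Rint_expR_affine ?gt_eqF// ler_piMl ?invr_ge0 ?ltW//.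
    by rewrite [Y * _]mulrC subrr expR0 gtrBl expR_gt0.
have := congr1 (fun x => F * x) Dl; rewrite /Delta mulr0.
have -> : F * (1 - cexp (ii * l * (2 * pi)%:C) + ii * Khat K l) =
  F - F * cexp (ii * l * (2 * pi)%:C) + ii * (F * Khat K l) by ring.
rewrite cexpNK => /eqP; rewrite addrAC subr_eq0 => /eqP E.
have := normcD F (ii * (F * Khat K l)); rewrite E Normc.normc1.
rewrite [X in _ + X]Normc.normcM normcI mul1r.
have -> : normc F = expR (- (2 * pi * Y)).
  by rewrite normc_cexp; congr expR; rewrite Yy !ReImE -/y; ring.
move=> H1 H2; have := le_trans H1 (lerD EY H2); clear; lra.
Qed.

Lemma Delta_nontrivial K : L2 K -> exists l, Delta K l != 0.
Proof.
move=> /zeros_Im_bounded[M M0 H]; exists (0 +i* (M + 1)); apply/eqP => /H /=.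
by rewrite ger0_norm ?addr_ge0 ?(ltW M0)// gerDl ler10.
Qed.

End zeros_in_strip.

(** * Power series of Delta and isolated zeros *)

Section isolated_zeros.
Context {R : realType}.
Context (K : R -> R[i]) (KL : L2 K).
Implicit Types (u v : R -> R[i]) (l z : R[i]).

Lemma normc_invfact m : normc ((m`!%:R)^-1 : R[i]) = (m`!%:R)^-1.
Proof. by rewrite Normc.normcV natrc_real normc_real ger0_norm. Qed.

(** The functional of the overview: linear, bounded for the sup norm on [0, 2 pi], with value
    Delta(l) at e^(ilt). *)
Definition Phi u := u 0 - u (2 * pi) + ii * cintegral (fun t => u t * K t).

Let Ki u : ccont u -> cintble (fun t => u t * K t).
Proof. by move=> cu; apply: cintble_contM => //; exact: L2_cintble. Qed.

Lemma PhiD u v : ccont u -> ccont v -> Phi (fun t => u t + v t) = Phi u + Phi v.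
Proof.
move=> cu cv; rewrite /Phi.
rewrite (eq_cint (g := fun t => u t * K t + v t * K t)) => [|t _]; last by rewrite mulrDl.
by rewrite cintD; [ring|exact: Ki..].
Qed.

Lemma PhiZ c u : ccont u -> Phi (fun t => c * u t) = c * Phi u.
Proof.
move=> cu; rewrite /Phi.
rewrite (eq_cint (g := fun t => c * (u t * K t))) => [|t _]; last by rewrite mulrA.
by rewrite cintZ; [ring|exact: Ki].
Qed.

Lemma Phi_le u (M : R) : ccont u -> (forall x, ccI x -> normc (u x) <= M) ->
  normc (Phi u) <= M * (2 + 2 * mass K).
Proof.
move=> cu uM; have p0 := @twopi_gt0 R.
have u0 : normc (u 0) <= M by apply: uM; rewrite /= in_itv/= lexx ltW.
have u2 : normc (u (2 * pi)) <= M by apply: uM; rewrite /= in_itv/= lexx ltW.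
have M0 : 0 <= M := le_trans (normc_ge0 _) u0.
apply: le_trans (normcD _ _) _; rewrite [X in _ + X]Normc.normcM normcI mul1r.
rewrite [leRHS]mulrDr; apply: lerD.
  by rewrite (le_trans (normcB _ _))// mulr_natr mulr2n lerD.
have -> : M * (2 * mass K) = 2 * M * mass K by ring.
by apply: cint_mass => // x /Omega_sub; exact: uM.
Qed.

Lemma DeltaE l : Delta K l = Phi (fun t => cexp (ii * l * t%:C)).
Proof. by rewrite /Phi mulr0 cexp0. Qed.

Section taylor_at.
Context (l0 : R[i]).

Let e t := cexp (ii * l0 * t%:C).
Let ce : ccont e. Proof. exact: ccont_cexpl. Qed.

(** Up to the factor i^m, the m-th derivative of Delta at [l0]. *)
Definition tcoef m := Phi (fun t => e t * t%:C ^+ m).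

Definition tpoly m z := Phi (fun t => e t * texp m (ii * z * t%:C)).

Definition trem m z := Phi (fun t => e t * rexp m (ii * z * t%:C)).

Lemma Delta_taylor m z : Delta K (l0 + z) = tpoly m z + trem m z.
Proof.
rewrite DeltaE /tpoly /trem -PhiD; last 2 first.
- by apply: ccontM => //; exact: ccont_texp.
- by apply: ccontM => //; exact: ccont_rexp.
congr Phi; apply/funext => t; rewrite /rexp /e.
by rewrite (_ : ii * (l0 + z) * t%:C = ii * l0 * t%:C + ii * z * t%:C) ?cexpD; ring.
Qed.

Lemma tpoly0 z : tpoly 0 z = 0.
Proof.
rewrite /tpoly (_ : (fun t => _) = (fun t => 0 * e t)); first by rewrite PhiZ ?mul0r.
by apply/funext => t; rewrite texp0 mulr0 mul0r.
Qed.

Lemma tpolyS m z : tpoly m.+1 z = tpoly m z + (ii * z) ^+ m * (m`!%:R)^-1 * tcoef m.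
Proof.
have ct : ccont (fun t : R => e t * t%:C ^+ m).
  by apply: ccontM => //; apply: ccontX; exact: ccont_id.
rewrite /tpoly /tcoef -PhiZ// -PhiD; last 2 first.
- by apply: ccontM => //; exact: ccont_texp.
- by apply: ccontM => //; exact: ccont_cst.
by congr Phi; apply/funext => t; rewrite texpS exprMn; ring.
Qed.

Definition tbound : R := expR (normc l0 * (2 * pi)) * (2 + 2 * mass K).

Lemma tbound_ge0 : 0 <= tbound.
Proof. by rewrite mulr_ge0 ?expR_ge0// addr_ge0// mulr_ge0// mass_ge0. Qed.

Lemma normc_scale_cc z t : ccI t -> normc (ii * z * t%:C) <= normc z * (2 * pi).
Proof.
rewrite /= in_itv/= => /andP[t0 t1].
by rewrite !Normc.normcM normcI mul1r normc_real ger0_norm// ler_wpM2l ?normc_ge0.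
Qed.

Lemma trem_le m z (Y : R) : normc z <= Y ->
  normc (trem m z) <= (2 * (Y * (2 * pi))) ^+ m * expR (Y * (2 * pi)) / m`!%:R * tbound.
Proof.
move=> zY; set X := _ / _; rewrite /tbound mulrA (mulrC X).
apply: Phi_le; first by apply: ccontM => //; exact: ccont_rexp.
move=> t tI; rewrite Normc.normcM ler_pM ?normc_ge0//.
  rewrite normc_cexp ler_expR (le_trans (ler_norm _))//.
  by rewrite (le_trans (normRe_le _))// normc_scale_cc.
apply: rexp_le_mono; rewrite (le_trans (normc_scale_cc _ tI))//.
by rewrite ler_pM2r// twopi_gt0.
Qed.

(** If all coefficients vanished, Delta(l0 + z) would equal its remainder of every order, hence be 0
    for every z, against [Delta_nontrivial]. *)
Lemma tcoef_neq0 : exists m, tcoef m != 0.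
Proof.
apply: contrapT => H.
have a0 m : tcoef m = 0.
  by apply/eqP/negPn/negP => am; apply: H; exists m.
have p0 m z : tpoly m z = 0.
  by elim: m => [|m IH]; rewrite ?tpoly0// tpolyS IH a0 mulr0 addr0.
have [l /eqP[]] := Delta_nontrivial KL.
rewrite -(subrK l0 l) addrC; move: (l - l0) => z.
apply/eqP; rewrite -normc_eq0 eq_le normc_ge0 andbT leNgt; apply/negP => D0.
pose E : R := expR (normc z * (2 * pi)) * tbound + 1.
have E0 : 0 < E by rewrite ltr_wpDl// mulr_ge0 ?expR_ge0 ?tbound_ge0.
pose x := normc (Delta K (l0 + z)).
have xE : 0 < x / (2 * E) by rewrite divr_gt0// mulr_gt0.
have [m [_ mX]] := expn_fact_cvg0 (2 * (normc z * (2 * pi))) xE.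
have := trem_le m (lexx (normc z)).
have -> : trem m z = Delta K (l0 + z) by rewrite (Delta_taylor m) p0 add0r.
rewrite -/x; move: mX; set q := (_ ^+ m).
have q0 : 0 <= q / m`!%:R.
  by rewrite divr_ge0// exprn_ge0// !mulr_ge0 ?normc_ge0 ?pi_ge0.
have -> : q * expR (normc z * (2 * pi)) / m`!%:R * tbound = q / m`!%:R * (E - 1).
  by rewrite /E addrK; ring.
rewrite ler_pdivlMr ?mulr_gt0//; have x0 : 0 < x by exact: D0.
rewrite mulrBr mulr1 mulrCA => A B.
have : x + x <= x.
  by rewrite (le_trans (lerD B B))// (le_trans _ A)// mulr_natl mulr2n lerD// gerBl.
by rewrite gerDl leNgt x0.
Qed.

(** Let m be the least index of a nonzero coefficient. At a zero l0 + z the leading term c |z|^m is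
    balanced by a remainder of at most C |z|^(m+1) for |z| < 1, which excludes small nonzero z. If
    Delta(l0) is nonzero then m = 0, and the same argument excludes every zero nearby, so the lemma
    applies at a cluster point whose value is unknown. *)
Lemma isolated_zero : exists2 r : R, 0 < r &
  forall z, normc z < r -> Delta K (l0 + z) = 0 -> z = 0.
Proof.
pose m := ex_minn tcoef_neq0.
have [am mmin] : tcoef m != 0 /\ forall j, (j < m)%N -> tcoef j = 0.
  rewrite /m; case: ex_minnP => k ak kmin; split=> // j jk.
  by apply/eqP/negPn/negP => /kmin; rewrite leqNgt jk.
have p0 j z : (j <= m)%N -> tpoly j z = 0.
  elim: j => [|j IH] jm; first exact: tpoly0.
  by rewrite tpolyS IH ?(ltnW jm)// mmin// mulr0 addr0.
pose c := normc (tcoef m) / m`!%:R.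
have c0 : 0 < c by rewrite divr_gt0 ?normc_gt0// ltr0n fact_gt0.
pose C : R := (2 * (2 * pi)) ^+ m.+1 * expR (2 * pi) / m.+1`!%:R * tbound.
have C0 : 0 <= C.
  rewrite mulr_ge0 ?tbound_ge0// divr_ge0// mulr_ge0 ?expR_ge0//.
  by rewrite exprn_ge0// !mulr_ge0 ?pi_ge0.
have C1 : 0 < C + 1 by rewrite ltr_wpDl.
exists (Num.min 1 (c / (C + 1))) => [|z]; first by rewrite lt_min ltr01 divr_gt0.
rewrite lt_min ltr_pdivlMr// => /andP[z1 zc] D0.
apply/eqP/negPn/negP => z0; have nz : 0 < normc z by rewrite normc_gt0.
have := trem_le m.+1 (lexx (normc z)).
have -> : normc (trem m.+1 z) = normc z ^+ m * c.
  have := Delta_taylor m.+1 z; rewrite D0 tpolyS p0// add0r => /esym/eqP.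
  rewrite addrC addr_eq0 => /eqP ->; rewrite normcN !Normc.normcM normc_invfact normcX.
  by rewrite Normc.normcM normcI mul1r /c -mulrA [X in _ * X]mulrC.
apply/negP; rewrite -ltNge.
apply: (@le_lt_trans _ _ (normc z ^+ m * (normc z * C))).
  have -> : normc z ^+ m * (normc z * C) = normc z ^+ m.+1 * C by rewrite exprSr mulrA.
  have -> : 2 * (normc z * (2 * pi)) = normc z * (2 * (2 * pi)) by ring.
  rewrite /C exprMn; set q := _ ^+ m.+1; set p := _ ^+ m.+1.
  have E1 : expR (normc z * (2 * pi)) <= expR (2 * pi).
    by rewrite ler_expR ler_piMl ?(ltW z1)// ltW// twopi_gt0.
  have -> : q * (p * expR (2 * pi) / m.+1`!%:R * tbound) =
    (q * p / m.+1`!%:R * tbound) * expR (2 * pi) by ring.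
  have -> : q * p * expR (normc z * (2 * pi)) / m.+1`!%:R * tbound =
    (q * p / m.+1`!%:R * tbound) * expR (normc z * (2 * pi)) by ring.
  apply: ler_wpM2l => //; rewrite mulr_ge0 ?tbound_ge0// divr_ge0// mulr_ge0//.
    by rewrite exprn_ge0// normc_ge0.
  by rewrite exprn_ge0// !mulr_ge0 ?pi_ge0.
rewrite ltr_pM2l ?exprn_gt0//; nra.
Qed.

End taylor_at.
End isolated_zeros.

(** * Finitely many zeros in a rectangle *)

Section finiteness.
Context {R : realType}.
Implicit Types (K : R -> R[i]) (l z : R[i]) (B : R).

Lemma finite_zeros K B : L2 K -> finite_set [set l : R[i] |
  [/\ `|Re l| <= B, `|Im l| <= B & Delta K l = 0]].
Proof.
move=> KL.
have /choice[r rP] (p : R * R) : exists e : R, 0 < e /\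
    forall z, normc z < e -> Delta K (p.1 +i* p.2 + z) = 0 -> z = 0.
  by have [e e0 eP] := isolated_zero KL (p.1 +i* p.2); exists e.
pose A : set (R * R) := `[- B, B] `*` `[- B, B].
have cA : compact A by apply: compact_setX; exact: segment_compact.
pose c (p : R * R) := p.1 +i* p.2.
pose Z : set (R * R) := [set p | A p /\ Delta K (c p) = 0].
suff fZ : finite_set Z.
  apply: sub_finite_set (finite_image c fZ) => -[a b] [/= aB bB D0].
  by exists (a, b) => //; split=> //; split; rewrite /= in_itv/= -ler_norml.
apply: contrapT => iZ.
(* A cluster point of the filter of sets containing all but finitely many points
   of Z would be a zero that is not isolated. *)
pose F : set_system (R * R) := [set S | finite_set (Z `\` S)].
have FF : ProperFilter F.
  split; first by rewrite /F /= setD0.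
  split.
  - by rewrite /F /= setDT; exact: finite_set0.
  - by move=> P Q FP FQ; rewrite /F /= setDIr; rewrite finite_setU.
  - by move=> P Q PQ; apply: sub_finite_set => x [Zx nQ]; split=> // /PQ.
have FA : F A.
  rewrite /F /= (_ : Z `\` A = set0); first exact: finite_set0.
  by apply/seteqP; split=> // x [[Ax _]].
have [p [Ap clp]] := cA F FF FA.
(* Balls of the product R * R are squares, so half the radius for each coordinate keeps the complex
   modulus below [r p]. *)
have [r0 rP'] := rP p; have r2 : 0 < r p / 2 by rewrite divr_gt0.
have FZ : F (Z `\ p).
  rewrite /F /=; apply: (@sub_finite_set _ _ [set p]); last exact: finite_set1.
  by move=> x [Zx nx]; apply: contrapT => xp; apply: nx.
have [q [[[Aq Dq] qp] [/= b1 b2]]] := clp _ _ FZ (nbhsx_ballx p _ r2).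
apply: qp; have /eqP : c q - c p = 0.
  apply: rP'; last by rewrite -/(c p) addrC subrK.
  rewrite (le_lt_trans (normc_le _))// (splitr (r p)).
  by rewrite !ReImE ltrD// distrC.
by rewrite subr_eq0 => /eqP[q1 q2]; rewrite [q]surjective_pairing q1 q2 -surjective_pairing.
Qed.

Lemma nearest_int (x : R) : exists m : int, `|x - m%:~R| <= 2^-1.
Proof.
exists (Num.floor (x + 2^-1)); have := floor_itv (x + 2^-1); rewrite intrD1.
by move: (_%:~R) => m /andP[m1 m2]; rewrite ler_norml; apply/andP; split; lra.
Qed.

Lemma absz_geE (N : nat) (n : int) : (N <= `|n|)%N = (N%:R <= `|n%:~R : R|).
Proof. by rewrite -intr_norm -natr_absz ler_nat. Qed.

End finiteness.

(** Uniqueness is a statement about small eps: for eps > 1 the disc around n also contains the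
    eigenvalues close to n - 1 and n + 1 once |n| is large. The additional eigenvalues are those
    that lie in none of the discs around integers n with |n| >= N. *)
Theorem theorem3p9 (R : realType) (K : R -> R[i]) (hK : L2 K) :
  forall eps : R, 0 < eps -> eps < 1 ->
  exists N : nat,
    (forall n : int, (N <= `|n|)%N ->
       exists! l : R[i],
         [/\ eigenvalues (P1 K) l, spectrum (P1 K) l &
             `|l - n%:~R| < eps%:C]) /\
    finite_set [set l : R[i] | eigenvalues (P1 K) l /\
       ~ exists n : int, (N <= `|n|)%N /\ `|l - n%:~R| < eps%:C].
Proof.
move=> eps e0 e1.
have [d0 d00 uniq_zero] := unique_zero_near_int hK.
(* d < eps puts the zero found inside the disc, and d + eps <= 1 prevents a number from being within
   d of one integer and within eps of another. *)
pose d := Num.min d0 (Num.min (eps / 2) (1 - eps)).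
have d_gt0 : 0 < d by rewrite !lt_min d00 divr_gt0//= subr_gt0.
have dd0 : d <= d0 by rewrite /d ge_min lexx.
have [de d1e] : d < eps /\ d <= 1 - eps.
  have : d <= eps / 2 /\ d <= 1 - eps by rewrite /d !ge_min !lexx !orbT.
  by move=> [? ?]; split=> //; lra.
have [N1 zeroP] := uniq_zero d d_gt0 dd0.
have d20 : 0 < d / 2 by rewrite divr_gt0.
have d21 : d / 2 <= 2^-1 by lra.
have [g g0 nearP] := near_integer d20 d21.
have [M M0 ImP] := zeros_Im_bounded hK.
(* For a zero l and the integer m nearest to Re l, |l - m| <= M + 1/2. *)
have [N2 KhatP] := riemann_lebesgue_unif (M + 1) hK g0.
(* With l = m + z, the equation says |1 - e^(2 pi i z)| = |Khat(m + z)|, which is below the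
   threshold [g] of [near_integer]. *)
have close l (m : int) : Delta K l = 0 -> (N2 <= `|m|)%N ->
    `|Re l - m%:~R| <= 2^-1 -> normc (l - m%:~R) < d.
  move=> Dl Nm lm; pose z := l - m%:~R.
  have lE : l = m%:~R + z by rewrite addrC subrK.
  have Rz : Re z = Re l - m%:~R by rewrite /z intrc_real !ReImE.
  have Iz : Im z = Im l by rewrite /z intrc_real !ReImE subr0.
  have zM : normc z <= M + 1.
    by rewrite (le_trans (normc_le _))// Rz Iz addrC lerD ?ImP// (le_trans lm)//; lra.
  rewrite -/z (_ : d = 2 * (d / 2)); last by field.
  apply: nearP; first by rewrite Rz.
  move: Dl; rewrite lE Delta_shift => /eqP; rewrite addr_eq0 => /eqP ->.
  by rewrite normcN Normc.normcM normcI mul1r KhatP.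
have normE (l : R[i]) (n : int) : (`|l - n%:~R| < eps%:C) = (normc (l - n%:~R) < eps).
  by rewrite normr_normc ltcR.
(* The successor leaves room for the integer m nearest to Re l: below, |n - m| < eps + 1/2 < 3/2, so
   |m| >= |n| - 1 >= N2. *)
pose N := (maxn N1 N2).+1.
exists N; split=> [n Nn|].
  have n1 : (N1 <= `|n|)%N by rewrite (leq_trans _ (ltnW Nn))// leq_maxl.
  have n2 : (N2 < `|n|)%N by rewrite (leq_trans _ Nn)// ltnS leq_maxr.
  have [z [zd Dz zuniq]] := zeroP n n1.
  exists (n%:~R + z); split.
    have ev : eigenvalues (P1 K) (n%:~R + z) by apply/eigenvalueE.
    split=> //; first exact: eigenvalue_spectrum.
    by rewrite normE addrC addKr (le_lt_trans zd).
  (* An eigenvalue within eps of n turns out to be within d of n, where the fixed point is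
     unique. *)
  move=> l [/(eigenvalueE hK) Dl _]; rewrite normE => ln.
  have [m lm] := nearest_int (Re l).
  have Rln : `|Re l - n%:~R| < eps.
    apply: le_lt_trans ln; apply: le_trans (normRe_le _).
    by rewrite intrc_real !ReImE.
  have nm : `|n%:~R - m%:~R : R| < eps + 2^-1.
    rewrite (_ : _ - _ = (Re l - m%:~R) - (Re l - n%:~R)); last by ring.
    by rewrite (le_lt_trans (ler_normB _ _))// addrC ltr_leD.
  have m2 : (N2 <= `|m|)%N.
    rewrite leqNgt; apply/negP => mN.
    have : (`|m|%N.+1)%:R <= N2%:R :> R by rewrite ler_nat.
    rewrite -natr1 natr_absz intr_norm.
    move: n2; rewrite (absz_geE (R := R)) -natr1.
    have := ler_normD (n%:~R - m%:~R : R) m%:~R; rewrite subrK.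
    by move: nm; move: `|_| `|_| `|_| => p q r; lra.
  have lmd := close l m Dl m2 lm.
  have mn : n = m.
    apply/eqP; rewrite -subr_eq0 -absz_eq0 -leqn0 -ltnS.
    rewrite ltnNge (absz_geE (R := R)) -ltNge rmorphB /=.
    rewrite (_ : _ - _ = (Re l - m%:~R) - (Re l - n%:~R)); last by ring.
    rewrite (le_lt_trans (ler_normB _ _))//.
    have : `|Re l - m%:~R| < d.
      apply: le_lt_trans lmd; apply: le_trans (normRe_le _).
      by rewrite intrc_real !ReImE.
    by move: Rln d1e; move: `|_| `|_| => p q; lra.
  rewrite -mn in lmd.
  by rewrite -(zuniq (l - n%:~R) (ltW lmd)) addrC subrK.
(* A zero with |Re l| > N + 1 has a nearest integer m with |m| >= N and lies within d < eps of it,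
   so the remaining ones fill only a rectangle. *)
apply: sub_finite_set (finite_zeros (Num.max M (N%:R + 1)) hK).
move=> l [/(eigenvalueE hK) Dl far]; split=> //; last first.
  by rewrite le_max ImP.
rewrite le_max orbC leNgt; apply/orP; left; apply/negP => lN.
have [m lm] := nearest_int (Re l).
have Nm : (N <= `|m|)%N.
  rewrite (absz_geE (R := R)).
  have := ler_normD (Re l - m%:~R) m%:~R; rewrite subrK.
  by move: lN lm; move: `|_| `|_| `|_| => p q r; lra.
apply: far; exists m; split=> //; rewrite normE; apply: lt_trans de.
by apply: close => //; rewrite (leq_trans _ (ltnW Nm))// leq_maxr.
Qed.
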